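(* Let $q$ be a prime, and for parameters $a,h$ (integers, viewed modulo $q$), positive integers $M,N$ and complex weights $\boldsymbol{\alpha}=\{\alpha_m\}$, $\boldsymbol{\beta}=\{\beta_n\}$ define $$ W_{a,q}(\boldsymbol{\alpha},\boldsymbol{\beta};h,M,N)=\sum_{M/2\le m<M}\ \sum_{N/2\le n<N}\alpha_m\beta_n\sum_{\substack{x\in\mathbb{F}_q\\ x^2=amn}}\mathbf{e}_q(hx). $$ For any positive integers $M,N\le q/2$ and any weights $\boldsymbol{\alpha}$ and $\boldsymbol{\beta}$ satisfying $\|\boldsymbol{\alpha}\|_\infty,\|\boldsymbol{\beta}\|_\infty\le 1$, we have $$ |W_{a,q}(\boldsymbol{\alpha},\boldsymbol{\beta};h,M,N)|\le q^{1/8+o(1)}(NM)^{3/4}\left(\frac{N^{3/16}}{q^{1/16}}+1\right)\left(\frac{M^{3/16}}{q^{1/16}}+1\right). $$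
   Context: $\mathbb{F}_q$ is the field of $q$ elements, $q$ prime; integers are viewed in $\mathbb{F}_q$ by reduction modulo $q$. $\mathbf{e}_q(z)=\exp(2\pi i z/q)$. $\|\boldsymbol{\alpha}\|_\infty=\max_m|\alpha_m|$, and similarly for $\boldsymbol{\beta}$. For a quantity $V>1$, $V^{o(1)}$ (as $V\to\infty$) denotes a function $U$ of $V$ satisfying $|U|\le V^{\varepsilon}$ for every $\varepsilon>0$, provided $V$ is large enough.
   Formalization: The parameters a and h are assumed not divisible by q; for a ≡ 0, or for h ≡ 0 with a = 1, the bound fails with all weights 1 and M = N = (q−1)/2, since W is then of order q² while the right side is q^{15/8+o(1)}. *)

(* Defs.v *)
From mathcomp Require Import all_boot all_order all_algebra.
From mathcomp Require Import all_classical all_reals all_analysis.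
From mathcomp Require Import complex.

Set Implicit Arguments.
Unset Strict Implicit.
Unset Printing Implicit Defensive.

Import Order.TTheory GRing.Theory Num.Theory.
Import numFieldNormedType.Exports.

Local Open Scope ring_scope.
Local Open Scope complex_scope.

Definition cmod (R : realType) (z : R[i]) : R := complex.Re `|z|.

(* exp(2 pi i z / q) *)
Definition add_char (R : realType) (q : nat) (z : int) : R[i] :=
  let t : R := 2 * pi * z%:~R / q%:R in cos t +i* sin t.

(* Sup norm over the indices M/2 <= m < M; the lower bound is a comparison of
   rational numbers, hence M <= 2 * m. The same range occurs in W. *)
Definition weight_norm (R : realType) (M : nat) (alpha : nat -> R[i]) : R :=
  \big[Num.max/0]_(0 <= m < M | (M <= 2 * m)%N) cmod (alpha m).

(* The exponential is evaluated at the integer h * x, with x represented in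
   [0, q); its value depends only on the class of h * x modulo q.
   For prime q, 'F_q is the field of integers modulo q. *)
Definition W (R : realType) (q : nat) (a : int) (alpha beta : nat -> R[i])
    (h : int) (M N : nat) : R[i] :=
  \sum_(0 <= m < M | (M <= 2 * m)%N) \sum_(0 <= n < N | (N <= 2 * n)%N)
    alpha m * beta n *
    \sum_(x : 'F_q | x ^+ 2 == a%:~R * m%:R * n%:R)
      add_char R q (h * (nat_of_ord x)%:Z).

(* U(V) is a V^{o(1)} as V tends to infinity. *)
Definition is_Vo1 (R : realType) (U : R -> R) : Prop :=
  forall eps : R, 0 < eps -> \forall V \near +oo, `|U V| <= V `^ eps.

(* Main.v *)
Require Import Defs.
From mathcomp Require Import all_boot all_order all_algebra.
From mathcomp Require Import zify ring lra.

(* Averaging over the factorizations x = u v turns W into bilinear forms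
   S = \sum_(u in U) \sum_(v in V) a_u b_v e_q(h u v), where U = {u : u^2 = b m}
   and V = {v : v^2 = b' n}, and two applications of Cauchy's inequality give
   |S|^8 <= q |U|^4 |V|^4 E(U) E(V) with E the additive energy. It remains to show
   E(U) <= q^o(1) M^2 (1 + M^(3/2) / q^(1/2)).

   For t <> 0, let J(t) be the number of solutions of u - v = t. Each of them gives
   r = m - n and s = m + n with s - s' = nu (r^2 - r'^2) for any two solutions,
   where nu = b / (2 t^2). The pairs (A, B) = (r^2 - r'^2, s - s') thus lie in the
   lattice nu A = B of determinant q inside the box |A| < M^2, |B| < M, and each
   pair is hit M^o(1) times by the divisor bound. If this lattice has no short vector,
   the box contains O(1 + M^3 / q) lattice points, whence J(t) = M^o(1) (1 +
   (M^3 / q)^(1/2)), and \sum_t J(t) <= |U|^2 concludes. Otherwise all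
   points (A, B) are multiples of one vector (A0, B0), so J(t)^2 <= M^o(1) M / |B0|;
   moreover all r^2 are congruent modulo A0, so that A0 = l g with g | l and
   J(t) <= M^o(1) (1 + M / l). As (A0, B0) determines t up to sign,
   summing (M / B0)^(1/2) (M / l) over B0, l <= M and g | l gives M^(2 + o(1)). *)

Set Implicit Arguments.
Unset Strict Implicit.
Unset Printing Implicit Defensive.

Import Order.TTheory GRing.Theory Num.Theory.

Local Open Scope ring_scope.

(** * The divisor bound *)

Definition tau (n : nat) : nat := size (divisors n).

Lemma tau_gt0 n : (0 < n)%N -> (0 < tau n)%N.
Proof.
move=> n0; rewrite /tau; case E: (divisors n) => [|? ?] //.
by have := dvdn1 1; have := dvd1n n; rewrite dvdn_divisors // E.
Qed.

(** A divisor [d] of [m n] is the product of [gcdn d m], which divides [m], and [d / gcdn d m],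
    which is coprime to [m / gcdn d m] and so divides [n]. *)
Lemma tauM m n : (0 < m)%N -> (0 < n)%N -> (tau (m * n) <= tau m * tau n)%N.
Proof.
move=> m0 n0; rewrite /tau -(size_allpairs muln).
apply: uniq_leq_size; first exact: divisors_uniq.
move=> d; rewrite -dvdn_divisors ?muln_gt0 ?m0 // => dmn.
apply/allpairsP; exists (gcdn d m, d %/ gcdn d m)%N => /=.
have g0 : (0 < gcdn d m)%N by rewrite gcdn_gt0 m0 orbT.
split; rewrite -?dvdn_divisors ?dvdn_gcdr //; last first.
  by rewrite mulnC divnK // dvdn_gcdl.
have cop : coprime (d %/ gcdn d m) (m %/ gcdn d m).
  rewrite /coprime -(eqn_pmul2r g0) muln_gcdl !divnK ?dvdn_gcdl ?dvdn_gcdr //.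
  by rewrite mul1n.
rewrite -(Gauss_dvdr n cop) -(dvdn_pmul2r g0) divnK ?dvdn_gcdl //.
by rewrite mulnAC divnK ?dvdn_gcdr.
Qed.

Lemma tau_pfactor p e : prime p -> (tau (p ^ e) <= e.+1)%N.
Proof.
move=> pp; rewrite /tau -[e.+1](size_iota 0) -(size_map (expn p) (iota _ _)).
apply: uniq_leq_size; first exact: divisors_uniq.
move=> d; rewrite -dvdn_divisors ?expn_gt0 ?prime_gt0 //.
case/(dvdn_pfactor _ _ pp) => k ke ->; apply/mapP; exists k => //.
by rewrite mem_iota add0n ltnS.
Qed.

(** This is the [k]-th power of [e + 1 <= k (e / k + 1) <= k 2^(e / k)], with integer quotients. *)
Lemma leq_exp_exp2 k e : (0 < k)%N -> (e.+1 ^ k <= k ^ k * 2 ^ e)%N.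
Proof.
move=> k0; apply: (@leq_trans ((k * (2 ^ (e %/ k))) ^ k)).
  rewrite leq_exp2r //; apply: (@leq_trans (k * (e %/ k).+1)).
    by rewrite mulnC ltn_ceil.
  by rewrite leq_mul2l ltn_expl ?orbT.
by rewrite expnMn -expnM leq_mul2l leq_pexp2l ?orbT ?leq_trunc_div.
Qed.

(* Only the primes below [2 ^ k] contribute a constant: above, (e+1)^k <= p^e. *)
Lemma tau_exp_leq k n : (0 < k)%N -> (0 < n)%N ->
  (tau n ^ k <= (k ^ k) ^ (2 ^ k) * n)%N.
Proof.
move=> k0 n0.
have C0 : (0 < k ^ k)%N by rewrite expn_gt0 k0.
suff: (tau n ^ k <= (k ^ k) ^ (count (fun p => p < 2 ^ k) (primes n)) * n)%N.
  move/leq_trans; apply; rewrite leq_mul2r; apply/orP; right.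
  rewrite leq_pexp2l // -size_filter -[leqRHS](size_iota 0).
  apply: uniq_leq_size; first by rewrite filter_uniq ?primes_uniq.
  by move=> p; rewrite mem_filter mem_iota /= add0n => /andP[].
elim/ltn_ind: n n0 => n IH n0.
have [n1|n1] := leqP n 1%N.
  have -> : n = 1%N by lia.
  by rewrite /= muln1 expn0 exp1n.
have [p pp pn] : exists2 p, prime p & (p %| n)%N.
  by exists (pdiv n); rewrite ?pdiv_prime ?pdiv_dvd.
have [m pm nE] := pfactor_coprime pp n0.
have m0 : (0 < m)%N by move: n0; rewrite nE muln_gt0 => /andP[].
have e0 : (0 < logn p n)%N by rewrite logn_gt0 mem_primes pp n0.
move: (logn p n) e0 nE => e' e0 nE.
have pe0 : (0 < p ^ e')%N by rewrite expn_gt0 prime_gt0.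
have pe1 : (1 < p ^ e')%N by rewrite -{1}(expn0 p) ltn_exp2l ?prime_gt1.
have mn : (m < n)%N by rewrite nE ltn_Pmulr.
have pE : perm_eq (primes n) (p :: primes m).
  apply: uniq_perm; rewrite /= ?primes_uniq ?andbT //.
    by rewrite mem_primes pp m0 /= -prime_coprime.
  move=> x; rewrite nE primesM // primesX // (primes_prime pp).
  by rewrite mem_seq1 in_cons orbC.
rewrite (permP pE) /= expnD [in leqRHS]nE.
apply: (@leq_trans ((tau m * tau (p ^ e')) ^ k)).
  by rewrite leq_exp2r // [in leqLHS]nE tauM.
rewrite expnMn mulnC [leqRHS]mulnACA.
rewrite [X in (_ <= X)%N](_ : _ = (((k ^ k) ^ (p < 2 ^ k)%N * p ^ e') *
  ((k ^ k) ^ count (fun p => p < 2 ^ k)%N (primes m) * m))%N); last by lia.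
apply: leq_mul; last exact: IH.
apply: (@leq_trans (e'.+1 ^ k)); first by rewrite leq_exp2r // tau_pfactor.
case: ltnP => h /=.
  rewrite expn1; apply: (leq_trans (leq_exp_exp2 _ k0)).
  by rewrite leq_mul2l leq_exp2r ?prime_gt1 ?orbT.
rewrite expn0 mul1n; apply: (@leq_trans ((2 ^ k) ^ e')).
  by rewrite -expnM mulnC expnM leq_exp2r // ltn_expl.
by rewrite leq_exp2r.
Qed.

(** The range reaches [x ^ 2] because the divisor bound is applied to differences of two squares;
    the shift [i.+1] leaves out 0. *)
Definition max_tau (x : nat) : nat := \max_(i < x ^ 2) tau i.+1.

Lemma leq_max_tau x n : (0 < n <= x ^ 2)%N -> (tau n <= max_tau x)%N.
Proof.
move=> /andP[n0 nx]; case: n n0 nx => // n _ nx.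
exact: (leq_bigmax (Ordinal nx)).
Qed.

Lemma max_tau_exp_leq k x : (0 < k)%N ->
  (max_tau x ^ k <= (k ^ k) ^ (2 ^ k) * x ^ 2)%N.
Proof.
move=> k0; rewrite /max_tau; elim/big_ind: _ => [|m n Hm Hn|i _].
- by rewrite exp0n.
- by rewrite /maxn; case: ifP.
- by apply: leq_trans (tau_exp_leq k0 _) _ => //; rewrite leq_mul2l ltn_ord orbT.
Qed.

(** * Counting pairs of points *)

Lemma card_leq_size (I : finType) (S : eqType) (P : {set I}) (f : I -> S)
    (s : seq S) :
  {in P &, injective f} -> (forall i, i \in P -> f i \in s) ->
  (#|P| <= size s)%N.
Proof.
move=> finj fs; rewrite cardE -(size_map f); apply: uniq_leq_size.
  rewrite map_inj_in_uniq ?enum_uniq // => i j.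
  by rewrite !mem_enum; apply: finj.
move=> y /mapP[i iP ->]; rewrite mem_enum in iP; exact: fs.
Qed.

Lemma card_leq_cover (I : finType) (S : eqType) (P : {set I}) (s : seq S)
    (rel : I -> S -> bool) :
  (forall i, i \in P -> exists2 v, v \in s & rel i v) ->
  (#|P| <= \sum_(v <- s) #|[set i in P | rel i v]|)%N.
Proof.
move=> Ps; under eq_bigr do rewrite -sum1dep_card.
rewrite (exchange_big_dep (mem P)) /=; last by move=> ? ? _ /andP[].
rewrite -sum1_card; apply: leq_sum => i iP; have [v vs iv] := Ps i iP.
by rewrite (big_rem _ vs) /= iP iv.
Qed.

Definition zdivisors (n : nat) : seq int :=
  [seq Posz d | d <- divisors n] ++ [seq - Posz d | d <- divisors n].

Lemma size_zdivisors n : size (zdivisors n) = (2 * tau n)%N.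
Proof. by rewrite size_cat !size_map mul2n addnn. Qed.

Lemma mem_zdivisors (n : nat) (d : int) :
  (0 < n)%N -> (`|d| %| n)%N -> d \in zdivisors n.
Proof.
move=> n0 dn; rewrite mem_cat; apply/orP.
have [d0|d0] := leP 0 d; [left|right]; apply/mapP; exists `|d|%N;
  rewrite -?dvdn_divisors //; lia.
Qed.

(** In [A = (r i - r j) (r i + r j)] the first factor is a signed divisor of [A]. It fixes the
    second factor, hence [r i] and [r j]. *)
Lemma card_sqr_diff (I : finType) (P : {set I}) (r : I -> int) (A : int) :
  {in P &, injective r} -> A != 0 ->
  (#|[set x in setX P P | (r x.1 ^+ 2 - r x.2 ^+ 2)%R == A]| <= 2 * tau `|A|)%N.
Proof.
move=> rinj A0; rewrite -size_zdivisors.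
apply: (@card_leq_size _ _ _ (fun x => r x.1 - r x.2)); last first.
  move=> [i j]; rewrite inE => /andP[_ /eqP e] /=; apply: mem_zdivisors.
    by rewrite absz_gt0.
  rewrite -e; apply/dvdnP; exists `|(r i + r j)%R|%N; rewrite -abszM; congr absz; ring.
move=> [i j] [i' j']; rewrite !inE /=.
move=> /andP[/andP[iP jP] /eqP e] /andP[/andP[i'P j'P] /eqP e'] dE.
have d0 : r i - r j != 0.
  by apply: contraNneq A0 => d0; rewrite -e subr_sqr d0 mul0r.
have sE : r i + r j = r i' + r j'.
  by apply: (mulfI d0); rewrite -subr_sqr e -e' subr_sqr -dE.
by congr pair; apply: rinj => //; lia.
Qed.

(** Equal squares force [r j = r i] or [r j = - r i], so [i] and one Boolean determine the pair. *)
Lemma card_eq_sqr (I : finType) (P : {set I}) (r : I -> int) :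
  {in P &, injective r} ->
  (#|[set x in setX P P | (r x.1 ^+ 2 == r x.2 ^+ 2)%R]| <= 2 * #|P|)%N.
Proof.
move=> rinj.
rewrite [leqRHS](_ : _ = size [seq (i, b) | i <- enum P, b <- [:: true; false]]);
  last by rewrite size_allpairs /= cardE mulnC.
apply: (@card_leq_size _ _ _ (fun x => (x.1, r x.1 == r x.2))).
  move=> [i j] [i' j']; rewrite !inE /=.
  move=> /andP[/andP[iP jP] e] /andP[/andP[i'P j'P] e'] [ii].
  move=> bb; rewrite -ii; congr pair; apply: rinj => //.
  move: e e' bb; rewrite -ii !eqf_sqr.
  case: (r i =P r j) => [<- _ _ /esym/eqP //|_ /= /eqP ij].
  by case: (r i =P r j') => //= _ /eqP ij' _; lia.
move=> [i j]; rewrite !in_set => /andP[/andP[iP _] _].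
by apply: (allpairs_f pair); rewrite ?mem_enum // !inE; case: (_ == r j).
Qed.

(** Pairs with equal squares give the term [2 #|P|]. The others are sorted by the vector of [L] they
    produce, and the divisor bound controls each fibre through its first coordinate. *)
Lemma card_sqr_leq (I : finType) (P : {set I}) (r s : I -> int) T
    (L : seq (int * int)) :
  {in P &, injective r} ->
  (forall i j, i \in P -> j \in P -> r i ^+ 2 != r j ^+ 2 ->
     (r i ^+ 2 - r j ^+ 2, s i - s j) \in L) ->
  (forall v, v \in L -> v.1 != 0 /\ (tau `|v.1| <= T)%N) ->
  (#|P| ^ 2 <= 2 * #|P| + 2 * T * size L)%N.
Proof.
move=> rinj PL LT.
have -> : (#|P| ^ 2 = #|setX P P|)%N by rewrite cardsX.
rewrite -(cardsID [set x | (r x.1 ^+ 2 == r x.2 ^+ 2)%R]); apply: leq_add.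
  by rewrite -setIdE; exact: card_eq_sqr.
set Q := _ :\: _.
have := @card_leq_cover _ _ Q L (fun x v => r x.1 ^+ 2 - r x.2 ^+ 2 == v.1).
move=> /(_ _)/leq_trans; apply.
  move=> [i j]; rewrite !inE /= => /andP[ne /andP[iP jP]].
  by exists (r i ^+ 2 - r j ^+ 2, s i - s j) => //; apply: PL.
have -> : (2 * T * size L = \sum_(v <- L) 2 * T)%N.
  by rewrite big_const_seq count_predT iter_addn_0.
rewrite big_seq [leqRHS]big_seq; apply: leq_sum => v /LT[v0 vT].
apply: (@leq_trans (2 * tau `|v.1|)); last by rewrite leq_mul2l vT orbT.
apply: leq_trans (card_sqr_diff rinj v0); apply: subset_leq_card.
by apply/subsetP => x; rewrite !inE => /andP[/andP[_ ->] ->].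
Qed.

(** * Lattice points in a box *)

Definition zrange (a n : nat) : seq int := [seq i%:Z - a%:Z | i <- iota 0 n].

Lemma size_zrange a n : size (zrange a n) = n.
Proof. by rewrite size_map size_iota. Qed.

Lemma mem_zrange a n (z : int) : - a%:Z <= z < n%:Z - a%:Z -> z \in zrange a n.
Proof.
move=> zan; apply/mapP; exists `|(z + a%:Z)%R|%N; last by lia.
by rewrite mem_iota; lia.
Qed.

Lemma dvdz_small_eq0 (d a : int) : (d %| a)%Z -> `|a| < `|d| -> a = 0.
Proof.
move=> /dvdzP[m ->]; rewrite normrM => lt.
have [->|m0] := eqVneq m 0; first exact: mul0r.
nia.
Qed.

(** The quotient selects a block of [|d|] consecutive integers, and such a block contains each
    residue class once. *)
Lemma eq_divz_eq (d a b : int) : d != 0 -> (d %| a - b)%Z ->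
  (a %/ `|d|)%Z = (b %/ `|d|)%Z -> a = b.
Proof.
move=> d0 dab ab; apply/eqP; rewrite -subr_eq0; apply/eqP.
apply: dvdz_small_eq0 dab _.
have := divz_eq a `|d|; have := divz_eq b `|d|; rewrite ab.
have n0 : (`|d| : int) != 0 by rewrite normr_eq0.
have := modz_ge0 a n0; have := modz_ge0 b n0.
have := ltz_mod a n0; have := ltz_mod b n0; rewrite normr_id.
lia.
Qed.

Lemma absz_itv (z : int) (n : nat) :
  (`|z| <= n)%N -> - n%:Z <= z < (2 * n + 1)%N%:Z - n%:Z.
Proof. lia. Qed.

Lemma absz_sub_leq (x y : int) : (`|(x - y)%R| <= `|x| + `|y|)%N.
Proof. lia. Qed.

(** Here [w] bounds the norm of [(A0, B0)] that rescales the box [N^2 x N] to a square; each of the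
    two products is at most [N w]. *)
Lemma cross_leq (A B A0 B0 : int) (N w : nat) :
  (`|A| < N ^ 2)%N -> (`|B| < N)%N -> (`|A0| <= w)%N -> (N * `|B0| <= w)%N ->
  (`|(A * B0 - A0 * B)%R| <= 2 * N * w)%N.
Proof.
move=> AN BN h1 h2; have N0 : (0 < N)%N by apply: leq_ltn_trans BN.
have h3 : (`|(A * B0 - A0 * B)%R| <= `|A| * `|B0| + `|A0| * `|B|)%N.
  by rewrite -!abszM; exact: absz_sub_leq.
apply: leq_trans h3 _; rewrite -(leq_pmul2l N0) mulnDr.
have k1 : (N * (`|A| * `|B0|) <= N ^ 2 * w)%N by rewrite mulnCA leq_mul // ltnW.
have k2 : (N * (`|A0| * `|B|) <= N ^ 2 * w)%N.
  by rewrite -mulnn -mulnA leq_mul2l (mulnC N) leq_mul ?orbT // ltnW.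
apply: leq_trans (leq_add k1 k2) _; rewrite -mulnn; clear; lia.
Qed.

(* The points of the lattice are sorted by the line parallel to [(A0, B0)] on
   which they lie; by coprimality their coordinates on one such line
   are determined modulo [A0] and modulo [B0]. *)
Lemma size_lattice_leq (q N w : nat) (A0 B0 : int) (L : seq (int * int)) :
  w = maxn `|A0| (N * `|B0|) -> (0 < q)%N -> coprimez A0 B0 ->
  (`|A0| < N ^ 2)%N -> (`|B0| < N)%N -> uniq L ->
  (forall v, v \in L -> [/\ (`|v.1| < N ^ 2)%N, (`|v.2| < N)%N
     & (q%:Z %| v.1 * B0 - A0 * v.2)%Z]) ->
  (size L <= (2 * (N ^ 2 %/ w) + 2) * (2 * (2 * N * w %/ q) + 1))%N.
Proof.
move=> wE q0 cop A0N B0N uL LP.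
have w0 : (0 < w)%N.
  rewrite wE leq_max absz_gt0; have [A00|//] := eqVneq A0 0.
  by move: cop; rewrite A00 /coprimez gcd0z => /eqP; lia.
set Q := (N ^ 2 %/ w)%N; set Z := (2 * N * w %/ q)%N.
set isA := (w == `|A0|)%N.
(* The first entry numbers the line through [v], the second the block on that line, measured in the
   coordinate where [w] is attained. *)
pose f v := (((v.1 * B0 - A0 * v.2) %/ q)%Z,
  if isA then (v.1 %/ `|A0|)%Z else (v.2 %/ `|B0|)%Z).
(* Lines are numbered from [-Z] to [Z]. Floor quotients of negative numbers reach one step further,
   so blocks run from [-(Q + 1)] to [Q]. *)
rewrite -(size_map f) mulnC -(size_zrange Q.+1 (2 * Q + 2)).
rewrite -(size_zrange Z (2 * Z + 1)) -(size_allpairs pair).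
apply: uniq_leq_size.
  rewrite map_inj_in_uniq // => -[A B] [A' B'] /LP[/= AN BN c] /LP[/= AN' BN' c'] [zz kk].
  have {zz} e : A * B0 - A0 * B = A' * B0 - A0 * B'.
    by rewrite -(divzK c) -(divzK c') zz.
  have dA : (A0 %| A - A')%Z.
    rewrite -(Gauss_dvdzl _ cop); apply/dvdzP; exists (B - B').
    have -> : (A - A') * B0 = A * B0 - A' * B0 by ring.
    have -> : A * B0 = A' * B0 - A0 * B' + A0 * B by rewrite -e; ring.
    ring.
  have dB : (B0 %| B - B')%Z.
    rewrite -(@Gauss_dvdzr _ A0) 1?coprimez_sym //; apply/dvdzP; exists (A - A').
    have -> : A0 * (B - B') = A0 * B - A0 * B' by ring.
    have -> : A0 * B = A * B0 - (A' * B0 - A0 * B') by rewrite -e; ring.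
    ring.
  move: kk; rewrite /isA; case: eqP => [wA|wA] kk.
    have A00 : A0 != 0 by rewrite -absz_gt0 -wA.
    have AA := eq_divz_eq A00 dA kk; congr pair => //.
    by apply: (mulfI A00); move: e; rewrite AA => /addrI/oppr_inj.
  have B00 : B0 != 0 by apply: contra_not_neq wA => B00; rewrite wE B00 muln0 maxn0.
  have BB := eq_divz_eq B00 dB kk; congr pair => //.
  by apply: (mulIf B00); move: e; rewrite BB => /addIr.
move=> _ /mapP[[A B] /LP[/= AN BN c] ->]; apply: (allpairs_f pair); apply: mem_zrange.
  set z := (_ %/ _)%Z; have := divzK c; rewrite -/z => zE.
  suff /absz_itv : (`|z| <= Z)%N by [].
  rewrite leq_divRL //.
  have -> : (`|z| * q = `|(A * B0 - A0 * B)%R|)%N by rewrite -zE abszM.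
  by apply: cross_leq; rewrite // wE ?leq_maxl ?leq_maxr.
(* The scale [y] is 1 for the first coordinate and [N] for the second, which treats both cases at
   once. *)
have key (d a x y : int) : d != 0 -> `|a| < x -> 0 < y -> y * `|d| = w%:Z ->
   y * x = (N ^ 2)%:Z -> - (Q.+1)%:Z <= (a %/ `|d|)%Z < (2 * Q + 2)%:Z - (Q.+1)%:Z.
  move=> d0 ax y0 yw yx; set k := (_ %/ _)%Z.
  have n0 : (`|d| : int) != 0 by rewrite normr_eq0.
  have := divz_eq a `|d|; rewrite -/k.
  have := modz_ge0 a n0; have := ltz_mod a n0; rewrite normr_id.
  have QP (m : nat) : m%:Z * `|d| < x -> (m <= Q)%N.
    move=> mx; rewrite leq_divRL //.
    suff : m%:Z * w%:Z <= (N ^ 2)%:Z by lia.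
    by rewrite -yw -yx mulrCA ler_pM2l // ltW.
  move: k (a %% _)%Z ax QP n0; clear; move: `|d| => D k rr ax QP D0 r1 r2 aE.
  have k1 : 0 <= k -> (`|k| <= Q)%N by move=> k0; apply: QP; nia.
  have k2 : k < 0 -> (`|(k + 1)%R| <= Q)%N by move=> k0; apply: QP; nia.
  lia.
rewrite /isA; case: eqP => [wA|wA].
  apply: (key _ _ (N ^ 2)%N%:Z 1); rewrite ?mul1r // -?abszE ?wA //.
  by rewrite -absz_gt0 -wA.
have wB : w = (N * `|B0|)%N by move: wA; rewrite wE /maxn; case: ltnP.
apply: (key _ _ N%:Z N%:Z); rewrite -?abszE -?PoszM ?mulnn ?wB ?ltz_nat //.
  by apply: contra_not_neq wA => B00; rewrite wE B00 muln0 maxn0.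
by apply: leq_ltn_trans BN.
Qed.

(** * Points whose squares are congruent *)

Lemma sum_leq_size_mul (S : eqType) (s : seq S) (F : S -> nat) :
  s != [::] -> exists2 x, x \in s & (\sum_(y <- s) F y <= size s * F x)%N.
Proof.
elim: s => // y [_ _|z s /(_ isT)[x xs IH] _].
  by exists y; rewrite ?mem_seq1 // big_seq1 mul1n.
rewrite big_cons.
have [xy|yx] := leqP (F x) (F y); [exists y|exists x];
  rewrite ?mem_head // ?[_ \in y :: _]in_cons ?xs ?orbT //; last first.
  by rewrite /= mulSn leq_add // ltnW.
by rewrite /= mulSn leq_add2l; apply: leq_trans IH _; rewrite leq_mul2l xy orbT.
Qed.

(** A block of length [l] holds at most one point of a residue class modulo [l], and the interval
    [(-N, N)] meets at most [2 (N / l) + 2] blocks. *)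
Lemma card_cong_leq (I : finType) (P : {set I}) (r : I -> int) (N l : nat) :
  (0 < l)%N -> {in P &, injective r} ->
  (forall i, i \in P -> (`|r i| < N)%N) ->
  (forall i j, i \in P -> j \in P -> (l%:Z %| r i - r j)%Z) ->
  (#|P| <= 2 * (N %/ l) + 2)%N.
Proof.
move=> l0 rinj rN rl; set Q := (N %/ l)%N.
have l0' : (l : int) != 0 by lia.
rewrite -(size_zrange Q.+1 (2 * Q + 2)).
apply: (@card_leq_size _ _ _ (fun i => (r i %/ `|l%:Z|)%Z)) => [i j iP jP e|i iP].
  by apply: rinj => //; apply: eq_divz_eq l0' (rl _ _ iP jP) e.
apply: mem_zrange; rewrite ger0_norm //.
have := divz_eq (r i) l; have := modz_ge0 (r i) l0'; have := ltz_mod (r i) l0'.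
have QP (m : nat) : (m * l < N)%N -> (m <= Q)%N by move=> ?; rewrite leq_divRL // ltnW.
have := rN _ iP; move: (r i) (_ %/ _)%Z (_ %% _)%Z => x k rr xN r1 r2 xE.
have k1 : 0 <= k -> (`|k| <= Q)%N by move=> k0; apply: QP; nia.
have k2 : k < 0 -> (`|(k + 1)%R| <= Q)%N by move=> k0; apply: QP; nia.
lia.
Qed.

(* Each [i] splits [A0 = d * (A0 / d)] with [d] dividing [r i - r i0] and
   [A0 / d] dividing [r i + r i0], so [r i] is fixed modulo [lcmn d (A0 / d)]. *)
Lemma card_sqr_cong_leq (I : finType) (P : {set I}) (r : I -> int) (N a T : nat) :
  (0 < a)%N -> {in P &, injective r} ->
  (forall i, i \in P -> (`|r i| < N)%N) ->
  (forall i j, i \in P -> j \in P -> (a%:Z %| r i ^+ 2 - r j ^+ 2)%Z) ->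
  (tau a <= T)%N ->
  exists l g : nat, [/\ a = (l * g)%N, (g %| l)%N &
    (#|P| <= T * (2 * (N %/ l) + 2))%N].
Proof.
move=> a0 rinj rN rA aT.
have [P0|/set0Pn[i0 i0P]] := eqVneq P set0.
  by exists a, 1%N; rewrite P0 cards0 muln1 dvd1n.
pose dd i := gcdn `|(r i - r i0)%R| a.
have ddP i : dd i \in divisors a by rewrite -dvdn_divisors ?dvdn_gcdr.
have aE d : (d %| a)%N -> a = (lcmn d (a %/ d) * gcdn d (a %/ d))%N.
  by move=> da; rewrite muln_lcm_gcd mulnC divnK.
have cardE : (#|P| <= \sum_(d <- divisors a) #|[set i in P | dd i == d]|)%N.
  by apply: card_leq_cover => i _; exists (dd i).
(* Pigeonhole: some divisor [d] of [a] collects at least a proportion [1 / tau a] of the points. *)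
have [|d dP] := @sum_leq_size_mul _ (divisors a) (fun d => #|[set i in P | dd i == d]|).
  by rewrite -size_eq0 -lt0n; apply: tau_gt0.
move=> /(leq_trans cardE) le; move: dP; rewrite -dvdn_divisors // => da.
exists (lcmn d (a %/ d)), (gcdn d (a %/ d)); split; first exact: aE.
  by apply: dvdn_trans (dvdn_gcdl _ _) (dvdn_lcml _ _).
apply: leq_trans le _; apply: leq_mul => //.
apply: (card_cong_leq (r := r)) => [|i j|i|i j].
- by move: a0; rewrite {1}(aE d) // muln_gt0 => /andP[].
- by rewrite !inE => /andP[? _] /andP[? _]; apply: rinj.
- by rewrite inE => /andP[/rN].
rewrite !inE => /andP[iP /eqP di] /andP[jP /eqP dj].
have d0 : (0 < d)%N by apply: dvdn_gt0 da.
have key k : k \in P -> dd k = d ->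
    (d%:Z %| r k - r i0)%Z /\ ((a %/ d)%N%:Z %| r k + r i0)%Z.
  move=> kP dk; split; first by rewrite -dk; apply: dvdn_gcdl.
  have := rA _ _ kP i0P; rewrite subr_sqr !dvdzE abszM !absz_nat.
  set x := `|(r k - _)%R|%N; set y := `|(r k + _)%R|%N => axy.
  have dx : (d %| x)%N by rewrite -dk dvdn_gcdl.
  (* Since [d] is the whole gcd of [x] and [a], the quotient [a / d] is coprime to [x / d], so it
     must divide [y]. *)
  have cop : coprime (a %/ d) (x %/ d).
    rewrite /coprime -(eqn_pmul2r d0) muln_gcdl !divnK // mul1n gcdnC.
    by apply/eqP.
  by rewrite -(Gauss_dvdr _ cop) -(dvdn_pmul2r d0) divnK // mulnAC divnK.
have [i1 i2] := key _ iP di; have [j1 j2] := key _ jP dj.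
rewrite dvdzE absz_nat dvdn_lcm; apply/andP; split.
  by move: (rpredB i1 j1); rewrite opprB addrA subrK dvdzE absz_nat.
by move: (rpredB i2 j2); rewrite opprD addrACA subrr addr0 dvdzE absz_nat.
Qed.

(** * The lattice dichotomy and points on a parabola modulo [q] *)

Lemma intr_Fp_eq0 (q : nat) (z : int) : prime q ->
  (z%:~R == 0 :> 'F_q) = (q%:Z %| z)%Z.
Proof. by move=> pq; rewrite (dvdz_pcharf (pchar_Fp pq)). Qed.

Lemma small_intr_Fp_eq0 (q : nat) (z : int) : prime q -> (`|z| < q)%N ->
  z%:~R = 0 :> 'F_q -> z = 0.
Proof.
move=> pq zq /eqP; rewrite intr_Fp_eq0 // => /dvdz_small_eq0; apply; lia.
Qed.

Lemma sqr_diff_lt (x y : int) (N : nat) : (`|x| < N)%N -> (`|y| < N)%N ->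
  (`|(x ^+ 2 - y ^+ 2)%R| < N ^ 2)%N.
Proof. nia. Qed.

Lemma coprimez_divg (A B : int) : A != 0 ->
  coprimez (A %/ gcdz A B)%Z (B %/ gcdz A B)%Z.
Proof.
move=> A0; have g0 : gcdz A B != 0 by rewrite gcdz_eq0 negb_and A0.
rewrite /coprimez -(inj_eq (mulIf g0)) mul1r -[X in _ * X]/(Posz `|gcdz A B|).
by rewrite mulz_gcdl !divzK ?dvdz_gcdl ?dvdz_gcdr.
Qed.

(** Any vector of [L], made primitive, serves as [(A1, B1)]; let [w] be its rescaled norm. If
    [2 N w < q], its determinant with each [v] in [L] is a multiple of [q] smaller than [q], so it
    vanishes and [L] lies on one line. Otherwise the point count is of order [(N^2 / w) (N w / q)],
    from which [w] cancels. *)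
Lemma lattice_dichotomy (q N : nat) (nu : 'F_q) (L : seq (int * int)) :
  prime q -> (2 * N <= q)%N -> uniq L -> L != [::] ->
  (forall v, v \in L -> [/\ v.1 != 0, v.2 != 0, (`|v.1| < N ^ 2)%N,
     (`|v.2| < N)%N & nu * v.1%:~R = v.2%:~R]) ->
  (size L * q <= 24 * N ^ 3)%N \/
  exists A0 B0 : int, [/\ A0 != 0 /\ B0 != 0,
    [/\ (`|A0| < q)%N, (`|A0| <= N ^ 2)%N & (`|B0| <= N)%N],
    nu * A0%:~R = B0%:~R, (size L * `|B0| <= 4 * N)%N
    & forall v, v \in L -> (A0 %| v.1)%Z].
Proof.
move=> pq Nq uL L0 LP; have q0 : (0 < q)%N by apply: prime_gt0.
have [[A B] vL] : exists v, v \in L.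
  by case: L L0 {uL LP} => // v L _; exists v; rewrite mem_head.
have [/= A0 B0 AN BN nuA] := LP _ vL.
have N0 : (0 < N)%N by apply: leq_ltn_trans BN.
set g := gcdz A B; have cop := coprimez_divg B A0; rewrite -/g in cop.
have gA : (g %| A)%Z by apply: dvdz_gcdl.
have gB : (g %| B)%Z by apply: dvdz_gcdr.
move: cop; set A1 := (A %/ g)%Z; set B1 := (B %/ g)%Z => cop.
have AE : A = A1 * g by rewrite divzK.
have BE : B = B1 * g by rewrite divzK.
have g0 : g != 0 by apply: contraNneq A0 => g0; rewrite AE g0 mulr0.
have A10 : A1 != 0 by apply: contraNneq A0 => e; rewrite AE e mul0r.
have B10 : B1 != 0 by apply: contraNneq B0 => e; rewrite BE e mul0r.
have gB' : (`|g| <= `|B|)%N by rewrite dvdn_leq ?absz_gt0 // -dvdzE.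
have A1A : (`|A1| <= `|A|)%N by rewrite AE abszM leq_pmulr // absz_gt0.
have B1B : (`|B1| <= `|B|)%N by rewrite BE abszM leq_pmulr // absz_gt0.
have A1N : (`|A1| < N ^ 2)%N by apply: leq_ltn_trans AN.
have B1N : (`|B1| < N)%N by apply: leq_ltn_trans BN.
have nuA1 : nu * A1%:~R = B1%:~R.
  (* The gcd satisfies [|g| <= |B| < N <= q], so it is invertible modulo [q] and the primitive
     vector stays in the lattice. *)
  have gq : g%:~R != 0 :> 'F_q.
    apply: contraNneq g0 => /(small_intr_Fp_eq0 pq) -> //.
    apply: leq_ltn_trans gB' (leq_trans BN (leq_trans _ Nq)).
    by rewrite leq_pmull.
  by apply: (mulIf gq); rewrite -mulrA -!intrM -AE -BE.
set w := maxn `|A1| (N * `|B1|).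
have wA : (`|A1| <= w)%N by apply: leq_maxl.
have wB : (N * `|B1| <= w)%N by apply: leq_maxr.
have wN : (w <= N ^ 2)%N.
  by rewrite geq_max (ltnW A1N) -mulnn leq_mul2l (ltnW B1N) orbT.
have w0 : (0 < w)%N by apply: leq_trans wA; rewrite absz_gt0.
have cross v : v \in L -> (q%:Z %| v.1 * B1 - A1 * v.2)%Z.
  move=> /LP[_ _ _ _ nuv]; rewrite -intr_Fp_eq0 // intrB !intrM -nuA1 -nuv.
  by apply/eqP; ring.
have := @size_lattice_leq q N w A1 B1 L erefl q0 cop A1N B1N uL.
have LP' v : v \in L -> [/\ (`|v.1| < N ^ 2)%N, (`|v.2| < N)%N
     & (q%:Z %| v.1 * B1 - A1 * v.2)%Z].
  by move=> vL'; have [_ _ ? ? _] := LP _ vL'; split=> //; apply: cross.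
move=> /(_ LP').
have Q0 : (0 < N ^ 2 %/ w)%N by rewrite divn_gt0.
have Qw : (N ^ 2 %/ w * w <= N ^ 2)%N by apply: leq_trunc_div.
have Zq : (2 * N * w %/ q * q <= 2 * N * w)%N by apply: leq_trunc_div.
have [wq|qw] := ltnP (2 * N * w) q.
  rewrite (divn_small wq) => sL; right; exists A1, B1; split=> //.
  - split; [|exact: ltnW|exact: ltnW].
    apply: leq_ltn_trans wq; apply: leq_trans wA _.
    by rewrite leq_pmull // muln_gt0.
  - apply: (@leq_trans (4 * (N ^ 2 %/ w) * `|B1|)).
      by rewrite leq_mul2r; apply/orP; right; move: sL Q0; clear; lia.
    rewrite -mulnA leq_mul2l /= -(leq_pmul2l N0) mulnCA mulnn.
    by apply: leq_trans Qw; rewrite leq_mul2l wB orbT.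
  move=> v vL'; have [v1 v2 v1N v2N _] := LP _ vL'.
  have /dvdz_small_eq0 cz := cross _ vL'.
  rewrite -(Gauss_dvdzl _ cop); apply/dvdzP; exists v.2.
  apply/eqP; rewrite mulrC [_ * A1]mulrC -subr_eq0 (mulrC B1); apply/eqP/cz.
  rewrite -!abszE ltz_nat absz_nat; apply: leq_ltn_trans wq.
  exact: cross_leq.
have Z0 : (0 < 2 * N * w %/ q)%N by rewrite divn_gt0.
move=> sL; left.
move: (N ^ 2 %/ w)%N (2 * N * w %/ q)%N Q0 Qw Zq Z0 sL => Q Z Q0 Qw Zq Z0 sL.
(* Both quotients are at least 1, so [2 Q + 2 <= 4 Q] and [2 Z + 1 <= 3 Z]. *)
have {}sL : (size L <= 12 * (Q * Z))%N.
  apply: leq_trans sL _.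
  rewrite (_ : 12 * (Q * Z) = (4 * Q) * (3 * Z))%N; last by clear; lia.
  by apply: leq_mul; move: Q0 Z0; clear; lia.
apply: (@leq_trans (12 * (Q * Z) * q)); first by rewrite leq_mul2r sL orbT.
have h1 : (Q * (Z * q) <= Q * (2 * N * w))%N by rewrite leq_mul2l Zq orbT.
have h2 : (N * (Q * w) <= N * N ^ 2)%N by rewrite leq_mul2l Qw orbT.
by move: h1 h2; rewrite -expnS; clear; lia.
Qed.

(** The points [(r, s)] lie on a parabola modulo [q], and their differences feed
    [lattice_dichotomy]. The three outcomes are few points, no short vector, and a short vector
    [(A0, B0)] with [|A0| = l g] and [|B0| = B]. *)
Lemma card_parabola (q N T : nat) (nu : 'F_q) (I : finType) (P : {set I})
    (r s : I -> int) :
  prime q -> nu != 0 -> (2 * N <= q)%N -> (0 < T)%N ->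
  (forall n, (0 < n <= N ^ 2)%N -> (tau n <= T)%N) ->
  {in P &, injective r} ->
  (forall i, i \in P -> (`|r i| < N)%N) ->
  (forall i j, i \in P -> j \in P -> (`|(s i - s j)%R| < N)%N) ->
  (forall i j, i \in P -> j \in P ->
     nu * (r i ^+ 2 - r j ^+ 2)%:~R = (s i - s j)%:~R) ->
  [\/ (#|P| <= 4 * T)%N, (#|P| ^ 2 * q <= 96 * T * N ^ 3)%N
    | exists (e : bool) (B l g : nat),
      [/\ (0 < B <= N)%N, (0 < l <= N)%N && (g %| l)%N,
        (l * g)%:R != 0 :> 'F_q /\ nu * ((-1) ^+ e * (l * g)%:R) = B%:R,
        (#|P| * l <= 4 * T * N)%N & (#|P| ^ 2 * B <= 16 * T * N)%N]].
Proof.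
move=> pq nu0 Nq T0 tauT rinj rN sN nuP.
pose L := undup [seq (r x.1 ^+ 2 - r x.2 ^+ 2, s x.1 - s x.2) |
  x <- enum [set x in setX P P | r x.1 ^+ 2 != r x.2 ^+ 2]].
have LP v : v \in L -> [/\ v.1 != 0, v.2 != 0, (`|v.1| < N ^ 2)%N,
     (`|v.2| < N)%N & nu * v.1%:~R = v.2%:~R].
  rewrite mem_undup => /mapP[[i j] ij ->] /=; move: ij; rewrite mem_enum !inE /=.
  move=> /andP[/andP[iP jP] ne].
  have ne0 : r i ^+ 2 - r j ^+ 2 != 0 by rewrite subr_eq0.
  split; [by []| |exact: sqr_diff_lt (rN _ iP) (rN _ jP)|exact: sN|exact: nuP].
  (* If [s i = s j], then [q] divides [r i - r j] or [r i + r j]; both are smaller than [2 N <= q],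
     so the squares would agree. *)
  apply: contraNneq ne0 => s0.
  have := nuP _ _ iP jP; rewrite s0 subr_sqr intrM => /eqP.
  rewrite !mulf_eq0 (negPf nu0) /= => /orP[] /eqP /(small_intr_Fp_eq0 pq) -> //;
    rewrite ?mul0r ?mulr0 //; have := rN _ iP; have := rN _ jP; move: Nq; clear; lia.
have cP := card_sqr_leq (s := s) (T := T) (L := L) rinj.
have {cP} JL : (#|P| ^ 2 <= 2 * #|P| + 2 * T * size L)%N.
  apply: cP => [i j iP jP ne|v /LP[v0 _ vN _ _]].
    rewrite mem_undup; apply/mapP; exists (i, j) => //.
    by rewrite mem_enum !inE iP jP.
  by split=> //; apply: tauT; rewrite absz_gt0 v0 ltnW.
have [J4|J4] := leqP #|P| 4.
  by constructor 1; apply: leq_trans J4 _; rewrite leq_pmulr.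
(* With more than four points, the diagonal term [2 #|P|] is at most half of [#|P| ^ 2] and is
   absorbed. *)
have {}JL : (#|P| ^ 2 <= 4 * T * size L)%N.
  by move: JL J4; rewrite -mulnn; clear; nia.
have [L0|L0] := eqVneq L [::].
  by move: JL; rewrite L0 muln0 leqn0 expn_eq0; case: #|P| J4.
have [Lq|[A0 [B0 [[A00 B00] [A0q A0N B0N] nuA LB LA]]]] :=
    lattice_dichotomy pq Nq (undup_uniq _) L0 LP.
  constructor 2; apply: (@leq_trans (4 * T * size L * q)).
    by rewrite leq_mul2r JL orbT.
  rewrite -mulnA (_ : 96 * T * N ^ 3 = 4 * T * (24 * N ^ 3))%N; last by ring.
  by rewrite leq_mul2l Lq orbT.
have [|||l [g [A0E gl Jl]]] := @card_sqr_cong_leq _ P r N `|A0| T _ rinj rN.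
- by rewrite absz_gt0.
- move=> i j iP jP.
  have [->|ne] := eqVneq (r i ^+ 2) (r j ^+ 2); first by rewrite subrr dvdz0.
  rewrite dvdzE absz_nat -dvdzE.
  apply: (LA (r i ^+ 2 - r j ^+ 2, s i - s j)).
  rewrite mem_undup; apply/mapP; exists (i, j) => //.
  by rewrite mem_enum !inE iP jP.
- by apply: tauT; rewrite absz_gt0 A00.
have l0 : (0 < l)%N by move: A00; rewrite -absz_gt0 A0E muln_gt0 => /andP[].
(* For [l > N] the quotient [N / l] is 0, and the bound falls under the first outcome. *)
have [lN|Nl] := leqP l N; last first.
  constructor 1; move: Jl; rewrite divn_small // muln0 add0n mulnC => /leq_trans; apply.
  by rewrite leq_mul2r orbT.
(* The sign [e] records whether [A0] and [B0] have opposite signs, so that only absolute values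
   remain. *)
constructor 3; exists ((A0 < 0) (+) (B0 < 0)), `|B0|%N, l, g.
split; rewrite ?absz_gt0 ?B00 ?B0N ?l0 ?lN ?gl //.
- rewrite -A0E; split.
    apply: contra_neq A00 => /(small_intr_Fp_eq0 pq (z := `|A0|%N)).
    rewrite absz_nat => /(_ A0q) /eqP; rewrite eqz_nat absz_eq0 => /eqP //.
  have aE (z : int) : `|z|%N%:R = (-1) ^+ (z < 0)%R * z%:~R :> 'F_q.
    by rewrite pmulrn abszE normrEsign intrM rmorph_sign.
  rewrite !aE signr_addb -nuA.
  by case: (A0 < 0); case: (B0 < 0); rewrite /= ?expr0 ?expr1; ring.
- apply: (@leq_trans (T * (2 * (N %/ l) + 2) * l)).
    by rewrite leq_mul2r Jl orbT.
  have h1 : (0 < N %/ l)%N by rewrite divn_gt0.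
  have h2 : (T * (N %/ l * l) <= T * N)%N by rewrite leq_mul2l leq_trunc_div orbT.
  have h3 : (T * l <= T * (N %/ l * l))%N by rewrite leq_mul2l leq_pmull ?orbT.
  by move: (N %/ l)%N h2 h3; clear; lia.
apply: (@leq_trans (4 * T * size L * `|B0|)).
  by rewrite leq_mul2r JL orbT.
by rewrite -mulnA (_ : 16 * T * N = 4 * T * (4 * N))%N ?leq_mul2l ?LB ?orbT //; ring.
Qed.

(** * The additive energy of modular square roots *)

Lemma ler_sum_mem (R : numDomainType) (S : eqType) (s : seq S) (F : S -> R) x :
  (forall y, 0 <= F y) -> x \in s -> F x <= \sum_(y <- s) F y.
Proof.
by move=> F0 xs; rewrite (big_rem _ xs) lerDl sumr_ge0.
Qed.

(** Telescoping: with [a = sqrt N] and [b = sqrt (N + 1)], the inequality [0 <= (a - b)^2] gives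
    [1 / b <= 2 (b - a)]. *)
Lemma sum_inv_sqrt (R : rcfType) (N : nat) :
  \sum_(1 <= B < N.+1) (Num.sqrt (B%:R : R))^-1 <= 2 * Num.sqrt N%:R.
Proof.
elim: N => [|N IH]; first by rewrite big_geq // sqrtr0 mulr0.
rewrite big_nat_recr //=; apply: (le_trans (lerD IH (lexx _))).
set a := Num.sqrt N%:R; set b := Num.sqrt N.+1%:R.
have b0 : 0 < b by rewrite sqrtr_gt0 ltr0n.
have a0 : 0 <= a by apply: sqrtr_ge0.
have a2 : a ^+ 2 = N%:R by rewrite sqr_sqrtr.
have b2 : b ^+ 2 = N%:R + 1 by rewrite sqr_sqrtr // -natr1.
rewrite -(ler_pM2r b0) mulrDl mulVf ?gt_eqF // -mulrA -mulrA -expr2 b2.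
have : 0 <= (a - b) ^+ 2 by apply: sqr_ge0.
rewrite sqrrB a2 b2; lra.
Qed.

(** Each dyadic block from [2^k] to [2^(k+1) - 1] contributes at most 1. *)
Lemma harmonic_leq (R : realFieldType) (N k : nat) : (N < 2 ^ k)%N ->
  \sum_(1 <= l < N.+1) (l%:R : R)^-1 <= k%:R.
Proof.
elim: k N => [|k IH] N Nk; first by rewrite big_geq.
have h (a b : nat) : (a <= b)%N ->
    \sum_(1 <= l < a.+1) (l%:R : R)^-1 <= \sum_(1 <= l < b.+1) (l%:R : R)^-1.
  move=> ab; rewrite (big_cat_nat (n := a.+1) _ (p := b.+1)) //= lerDl sumr_ge0 // => i _.
  by rewrite invr_ge0.
have k0 : (0 < 2 ^ k)%N by rewrite expn_gt0.
apply: (le_trans (h N (2 ^ k.+1).-1 _)); first by rewrite -ltnS prednK ?expn_gt0.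
rewrite prednK ?expn_gt0 // (big_cat_nat (n := 2 ^ k)) //=; last by rewrite leq_exp2l.
rewrite -[k.+1]addn1 natrD; apply: lerD.
  by have := IH (2 ^ k).-1; rewrite prednK //; apply.
apply: (@le_trans _ _ (\sum_(2 ^ k <= l < 2 ^ (k + 1)) ((2 ^ k)%:R : R)^-1)).
  apply: ler_sum_nat => l /andP[l1 _].
  by rewrite lef_pV2 ?posrE ?ltr0n ?ler_nat // (leq_trans k0).
rewrite big_const_nat iter_addr_0 expnD expn1 muln2 -addnn addnK.
by rewrite -[X in X <= _]mulr_natr mulVf // pnatr_eq0 -lt0n.
Qed.

Lemma leq_tau_exp2 k : (k < tau (2 ^ k))%N.
Proof.
rewrite -(size_iota 0 k.+1) -(size_map (expn 2)) uniq_leq_size //.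
  by rewrite map_inj_uniq ?iota_uniq //; apply: expnI.
move=> d /mapP[i ik ->]; move: ik; rewrite mem_iota add0n => /andP[_ ik].
by rewrite -dvdn_divisors ?expn_gt0 // dvdn_exp2l.
Qed.

(** * Differences of modular square roots *)

Definition root_set (q : nat) (b : 'F_q) (N : nat) : {set 'F_q} :=
  [set u | (u != 0) && [exists n : 'I_N, (N <= 2 * n)%N && (u ^+ 2 == b * n%:R)]].

(** The representation function of differences; its second moment over [t] is the additive energy of
    [U]. *)
Definition ndiff (V : finZmodType) (U : {set V}) (t : V) : nat :=
  #|[set x in setX U U | x.1 - x.2 == t]|.

Lemma sum_ndiff (V : finZmodType) (U : {set V}) :
  (\sum_t ndiff U t = #|U| ^ 2)%N.
Proof.
rewrite -mulnn -cardsX -sum1_card (partition_big (fun x => x.1 - x.2) predT) //=.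
by apply: eq_bigr => t _; rewrite sum1dep_card.
Qed.

Lemma ndiff0 (V : finZmodType) (U : {set V}) : ndiff U 0 = #|U|.
Proof.
rewrite -(card_imset _ (f := fun u => (u, u))); last by move=> u v [].
apply: eq_card => -[u v]; rewrite !inE /= subr_eq0.
apply/andP/imsetP => [[/andP[uU _] /eqP <-]|[w wU [-> ->]]]; first by exists u.
by rewrite wU eqxx.
Qed.

Lemma card_sqr_roots (F : finFieldType) (c : F) :
  (#|[set u | u ^+ 2 == c]| <= 2)%N.
Proof.
have [->|/set0Pn[v vc]] := eqVneq [set u | u ^+ 2 == c] set0; first by rewrite cards0.
move: vc; rewrite inE => /eqP <-; apply: (@leq_trans #|[set v; - v]|).
  by apply: subset_leq_card; apply/subsetP => u; rewrite !inE eqf_sqr.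
by rewrite cards2; case: (_ != _).
Qed.

Lemma card_root_set (q N : nat) (b : 'F_q) : (#|root_set b N| <= 2 * N)%N.
Proof.
have := @card_leq_cover _ _ (root_set b N) (iota 0 N) (fun u n => u ^+ 2 == b * n%:R).
move=> /(_ _)/leq_trans; apply.
  move=> u; rewrite inE => /andP[_ /existsP[n /andP[_ un]]].
  by exists (n : nat); rewrite ?mem_iota ?ltn_ord.
have -> : (2 * N = \sum_(n <- iota 0 N) 2)%N.
  by rewrite big_const_seq count_predT size_iota iter_addn_0.
apply: leq_sum => n _; apply: leq_trans (card_sqr_roots (b * n%:R)).
by apply: subset_leq_card; apply/subsetP => u; rewrite !inE => /andP[].
Qed.

Lemma natr_Fp_neq0 (q n : nat) : prime q -> (0 < n < q)%N -> n%:R != 0 :> 'F_q.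
Proof.
move=> pq /andP[n0 nq].
by rewrite -(dvdn_pcharf (pchar_Fp pq)) gtnNdvd.
Qed.

(* If [u - v = t], [u ^ 2 = b m] and [v ^ 2 = b n], then [r = m - n] and [s = m + n]
   satisfy [u + v = b r / t] and [2 b s = (u + v) ^ 2 + t ^ 2]. *)
Lemma ndiff_root_set (q N T : nat) (b t : 'F_q) :
  prime q -> (2 < q)%N -> (2 * N <= q)%N -> (0 < T)%N ->
  (forall n, (0 < n <= N ^ 2)%N -> (tau n <= T)%N) -> b != 0 -> t != 0 ->
  let J := ndiff (root_set b N) t in
  [\/ (J <= 4 * T)%N, (J ^ 2 * q <= 96 * T * N ^ 3)%N
    | exists (e : bool) (B l g : nat),
      [/\ (0 < B <= N)%N, (0 < l <= N)%N && (g %| l)%N,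
        b / (2 * t ^+ 2) * ((-1) ^+ e * (l * g)%:R) = B%:R,
        (J * l <= 4 * T * N)%N & (J ^ 2 * B <= 16 * T * N)%N]].
Proof.
move=> pq q2 Nq T0 tauT b0 t0 J.
have n2 : 2 != 0 :> 'F_q by apply: natr_Fp_neq0.
(* A chosen index [n] with [u^2 = b n]; the default 0 is taken only when no such index exists. *)
pose nn (u : 'F_q) : nat :=
  odflt 0%N (omap (@nat_of_ord N)
    [pick n : 'I_N | (N <= 2 * n)%N && (u ^+ 2 == b * n%:R)]).
have nnP u : u \in root_set b N ->
    [/\ (nn u < N)%N, (N <= 2 * nn u)%N & u ^+ 2 = b * (nn u)%:R].
  rewrite inE => /andP[_ /existsP ex]; rewrite /nn.
  case: pickP => [n /andP[Nn /eqP un]|no]; first by split=> //=; apply: ltn_ord.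
  by case: ex => n'; rewrite no.
pose r (x : 'F_q * 'F_q) : int := (nn x.1)%:Z - (nn x.2)%:Z.
pose s (x : 'F_q * 'F_q) : int := (nn x.1)%:Z + (nn x.2)%:Z.
set P := [set x in setX (root_set b N) (root_set b N) | x.1 - x.2 == t].
have PP x : x \in P -> [/\ x.1 \in root_set b N, x.2 \in root_set b N & x.1 - x.2 = t].
  by case: x => u v; rewrite !inE /= -!andbA => /and5P[-> -> -> -> /eqP].
have rE x : x \in P -> x.1 + x.2 = b * (r x)%:~R / t.
  move=> /PP[/nnP[_ _ e1] /nnP[_ _ e2] dx].
  apply: (mulIf t0); rewrite divfK // -[X in _ * X]dx mulrC -subr_sqr e1 e2.
  by rewrite intrB -!pmulrn mulrBr.
have sE x : x \in P -> (s x)%:~R = b / (2 * t ^+ 2) * (r x ^+ 2)%:~R + t ^+ 2 / (2 * b).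
  move=> xP; have [/nnP[_ _ e1] /nnP[_ _ e2] dx] := PP _ xP.
  have b2 : 2 * b != 0 by rewrite mulf_neq0.
  apply: (mulfI b2).
  have -> : 2 * b * (s x)%:~R = (x.1 + x.2) ^+ 2 + (x.1 - x.2) ^+ 2.
    rewrite intrD -!pmulrn -mulrA mulrDr -e1 -e2; ring.
  by rewrite rE // dx rmorphXn /=; field; rewrite t0 b0 n2.
have [|||||||] := @card_parabola q N T (b / (2 * t ^+ 2)) _ P r s pq _ Nq T0 tauT.
- by rewrite mulf_neq0 // invr_neq0 // mulf_neq0 // expf_neq0.
(* By [rE], the value of [r] determines [u + v]; with [u - v = t] this determines the pair, as 2 is
   invertible. *)
- move=> x y xP yP xy.
  have := rE _ xP; rewrite xy -(rE _ yP) => sxy.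
  have [_ _ dx] := PP _ xP; have [_ _ dy] := PP _ yP.
  have e1 : x.1 = y.1.
    apply: (mulfI n2); transitivity ((x.1 + x.2) + (x.1 - x.2)); first by ring.
    by rewrite sxy dx -dy; ring.
  have e2 : x.2 = y.2 by apply: (addrI x.1); rewrite sxy e1.
  by move: e1 e2; case: (x) (y) => [? ?] [? ?] /= -> ->.
- move=> x /PP[/nnP[h1 _ _] /nnP[h2 _ _] _]; rewrite /r.
  by move: (nn x.1) (nn x.2) h1 h2; clear; lia.
(* The dyadic range matters here: [s] lies between [N] and [2 N - 2], so two values differ by less
   than [N]. *)
- move=> x y /PP[/nnP[h1 h2 _] /nnP[h3 h4 _] _] /PP[/nnP[k1 k2 _] /nnP[k3 k4 _] _].
  rewrite /s; move: (nn x.1) (nn x.2) (nn y.1) (nn y.2) h1 h2 h3 h4 k1 k2 k3 k4.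
  by clear; lia.
- by move=> x y xP yP; rewrite !intrB !sE //; ring.
- by constructor 1.
- by constructor 2.
move=> [e [B [l [g [h1 h2 [_ h3] h4 h5]]]]].
by constructor 3; exists e, B, l, g.
Qed.

(** The logarithm is absorbed into [T]: a power of two [2^k <= N] already has [k + 1] divisors. *)
Lemma harmonic_leq_tau (R : realFieldType) (N T : nat) :
  (forall n, (0 < n <= N ^ 2)%N -> (tau n <= T)%N) ->
  \sum_(1 <= l < N.+1) (l%:R : R)^-1 <= T%:R.
Proof.
move=> tauT; have [->|N0] := posnP N; first by rewrite big_geq.
apply: (le_trans (harmonic_leq R (k := (trunc_log 2 N).+1) _)).
  by rewrite trunc_log_ltn.
rewrite ler_nat; apply: leq_trans (leq_tau_exp2 _) (tauT _ _).
rewrite expn_gt0 /=; apply: leq_trans (trunc_logP _ N0) _ => //.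
by rewrite -mulnn leq_pmulr.
Qed.

(** The product of the two bounds [J <= 4 T N / l] and [J <= 4 T sqrt (N / B)]; the second weakens
    [sqrt T] to [T]. *)
Lemma sqr_mixed_leq (R : rcfType) (J T N B l : nat) : (0 < B)%N -> (0 < l)%N ->
  (0 < T)%N ->
  (J * l <= 4 * T * N)%N -> (J ^ 2 * B <= 16 * T * N)%N ->
  J%:R ^+ 2 <=
    16 * T%:R ^+ 2 * (N%:R * Num.sqrt N%:R) * (Num.sqrt B%:R)^-1 * (l%:R)^-1 :> R.
Proof.
move=> B0 l0 T0 h1 h2.
have sB : 0 < Num.sqrt (B%:R : R) by rewrite sqrtr_gt0 ltr0n.
have sl : 0 < l%:R :> R by rewrite ltr0n.
rewrite -(ler_pM2r sl) mulfVK ?gt_eqF // -(ler_pM2r sB) mulrAC mulfVK ?gt_eqF //.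
have k1 : J%:R * l%:R <= 4 * T%:R * N%:R :> R by rewrite -!natrM ler_nat.
have k2 : J%:R * Num.sqrt B%:R <= 4 * T%:R * Num.sqrt N%:R :> R.
  rewrite -ler_sqr ?nnegrE ?mulr_ge0 ?sqrtr_ge0 ?ler0n // !exprMn !sqr_sqrtr //.
  rewrite -!natrX -!natrM ler_nat; apply: leq_trans h2 _.
  rewrite leq_mul2r; apply/orP; right; move: T0; clear; nia.
have -> : J%:R ^+ 2 * Num.sqrt B%:R * l%:R =
    (J%:R * l%:R) * (J%:R * Num.sqrt B%:R) :> R by ring.
have -> : 16 * T%:R ^+ 2 * (N%:R * Num.sqrt N%:R) =
    (4 * T%:R * N%:R) * (4 * T%:R * Num.sqrt N%:R) :> R by ring.
by apply: ler_pM; rewrite ?mulr_ge0 ?sqrtr_ge0 ?ler0n.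
Qed.

(** A square root is taken after [96 T <= (10 T)^2]. *)
Lemma sqr_large_leq (R : rcfType) (J T N q : nat) : (0 < q)%N -> (0 < T)%N ->
  (J ^ 2 * q <= 96 * T * N ^ 3)%N ->
  J%:R <= 10 * T%:R * Num.sqrt (N%:R ^+ 3 / q%:R) :> R.
Proof.
move=> q0 T0 h.
have x0 : 0 <= N%:R ^+ 3 / q%:R :> R by rewrite divr_ge0 // exprn_ge0.
rewrite -ler_sqr ?nnegrE ?mulr_ge0 ?sqrtr_ge0 ?ler0n // exprMn sqr_sqrtr //.
rewrite mulrA ler_pdivlMr ?ltr0n // -natrM -!natrX -!natrM ler_nat.
apply: leq_trans h _; rewrite leq_mul2r; apply/orP; right.
by move: T0; rewrite -mulnn; clear; nia.
Qed.

(** The first two outcomes of [ndiff_root_set] bound [J(t)] uniformly and are summed with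
    [\sum_t J(t) = |U|^2]. The third is summed over its parameters. The constant is
    [172 = 4 + 40 + 128], from [t = 0], the uniform part and the short vectors. *)
Lemma energy_root_set (R : rcfType) (q N T : nat) (b : 'F_q) :
  prime q -> (2 < q)%N -> (2 * N <= q)%N -> (0 < T)%N ->
  (forall n, (0 < n <= N ^ 2)%N -> (tau n <= T)%N) -> b != 0 ->
  \sum_t (ndiff (root_set b N) t)%:R ^+ 2 <=
    172 * T%:R ^+ 4 * N%:R ^+ 2 * (1 + Num.sqrt (N%:R ^+ 3 / q%:R)) :> R.
Proof.
move=> pq q2 Nq T0 tauT b0; set U := root_set b N; set S := Num.sqrt _.
have q0 : (0 < q)%N by apply: prime_gt0.
have S0 : 0 <= S by apply: sqrtr_ge0.
have T1 : 1 <= T%:R :> R by rewrite ler1n.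
have N0 : 0 <= N%:R :> R by apply: ler0n.
have TR0 : 0 <= T%:R :> R by apply: ler0n.
pose G (B l : nat) : R :=
  16 * T%:R ^+ 2 * (N%:R * Num.sqrt N%:R) * (Num.sqrt B%:R)^-1 * (l%:R)^-1.
have G0 B l : 0 <= G B l.
  by rewrite /G !mulr_ge0 ?exprn_ge0 ?invr_ge0 ?sqrtr_ge0.
pose rel (e : bool) (B l g : nat) (t : 'F_q) : bool :=
  b / (2 * t ^+ 2) * ((-1) ^+ e * (l * g)%:R) == B%:R.
(* The parameters depend on [t], so the bound adds [G] over all compatible parameters; the terms are
   nonnegative and one of them suffices. *)
have main t : t != 0 -> (ndiff U t)%:R ^+ 2 <= 10 * T%:R * (1 + S) * (ndiff U t)%:R +
   \sum_(e <- [:: true; false]) \sum_(1 <= B < N.+1) \sum_(1 <= l < N.+1)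
     \sum_(g <- divisors l) (rel e B l g t)%:R * G B l.
  move=> t0; set J := ndiff U t.
  set X := (X in _ + X).
  have X0 : 0 <= X by do 4![apply: sumr_ge0 => ? _]; apply: mulr_ge0; rewrite ?ler0n.
  have aux : J%:R <= 10 * T%:R * (1 + S) -> J%:R ^+ 2 <= 10 * T%:R * (1 + S) * J%:R + X.
    by move=> h; rewrite -[leLHS]addr0 lerD // expr2 ler_wpM2r.
  have [h|h|[e [B [l [g [h1 h2 h3 h4 h5]]]]]] :=
      @ndiff_root_set q N T b t pq q2 Nq T0 tauT b0 t0.
  - apply: aux; have : J%:R <= 4 * T%:R :> R by rewrite -natrM ler_nat.
    have := mulr_ge0 TR0 S0; lra.
  - apply: aux; have := sqr_large_leq R q0 T0 h; rewrite -/S -/J.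
    lra.
  have [/andP[B0 BN] /andP[/andP[l0 lN] gl]] := (h1, h2).
  have := sqr_mixed_leq R B0 l0 T0 h4 h5; rewrite -/(G B l) -/J => JG.
  rewrite -[leLHS]add0r; apply: lerD; first by rewrite !mulr_ge0 ?addr_ge0.
  apply: (le_trans JG); rewrite /X.
  have nn (e' : bool) (B' l' g' : nat) : 0 <= (rel e' B' l' g' t)%:R * G B' l'.
    by rewrite mulr_ge0.
  apply: (le_trans _ (ler_sum_mem (x := e) _ _)); last by case: (e).
    apply: (le_trans _ (ler_sum_mem (x := B) _ _)); last by rewrite mem_index_iota B0.
      apply: (le_trans _ (ler_sum_mem (x := l) _ _)); last by rewrite mem_index_iota l0.
        apply: (le_trans _ (ler_sum_mem (x := g) _ _)); last by rewrite -dvdn_divisors.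
          by rewrite /rel h3 eqxx mul1r.
        by [].
      by move=> ?; apply: sumr_ge0.
    by move=> ?; do 2!apply: sumr_ge0 => ? _.
  by move=> ?; do 3!apply: sumr_ge0 => ? _.
(* The relation fixes [t^2], hence [t] up to sign. *)
have cnt (e : bool) (B l g : nat) : (0 < B <= N)%N ->
    \sum_(t | t != 0) (rel e B l g t)%:R <= 2 :> R.
  move=> /andP[B0 BN].
  rewrite -natr_sum ler_nat -big_mkcondr /= sum1dep_card.
  have n2 : 2 != 0 :> 'F_q by apply: natr_Fp_neq0.
  have nB : B%:R != 0 :> 'F_q.
    by apply: natr_Fp_neq0; rewrite // B0 /=; move: B0 BN Nq; clear; lia.
  apply: leq_trans (card_sqr_roots (b * ((-1) ^+ e * (l * g)%:R) / (2 * B%:R))).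
  apply: subset_leq_card; apply/subsetP => t; rewrite !inE => /andP[t0 /eqP e1].
  have -> : b * ((-1) ^+ e * (l * g)%:R) = B%:R * (2 * t ^+ 2).
    by rewrite -e1; field; rewrite t0 n2.
  by apply/eqP; field; rewrite nB n2.
(* Summing over [t] and [g] costs [2 T], over [l] a harmonic sum at most [T], over [B] a factor
   [2 sqrt N], over [e] a factor 2; with the 16 of [G] this is 128. *)
have sum2 : \sum_(t | t != 0) \sum_(e <- [:: true; false]) \sum_(1 <= B < N.+1)
    \sum_(1 <= l < N.+1) \sum_(g <- divisors l) (rel e B l g t)%:R * G B l
    <= 128 * T%:R ^+ 4 * N%:R ^+ 2.
  have inner (e : bool) (B l : nat) : (0 < B <= N)%N -> (0 < l <= N)%N ->
      \sum_(t | t != 0) \sum_(g <- divisors l) (rel e B l g t)%:R * G B l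
      <= 2 * T%:R * G B l.
    move=> BN /andP[l0 lN]; rewrite exchange_big /=.
    apply: (@le_trans _ _ (\sum_(g <- divisors l) 2 * G B l)).
      by apply: ler_sum => g _; rewrite -mulr_suml ler_wpM2r // cnt.
    rewrite big_const_seq count_predT iter_addr_0 -[X in X <= _]mulr_natl mulrA.
    rewrite ler_wpM2r // mulrC ler_wpM2l // ler_nat tauT // l0 (leq_trans lN) //.
    by rewrite -mulnn leq_pmull // (leq_trans l0).
  have middle (e : bool) (B : nat) : (0 < B <= N)%N ->
      \sum_(t | t != 0) \sum_(1 <= l < N.+1) \sum_(g <- divisors l)
        (rel e B l g t)%:R * G B l
      <= 32 * T%:R ^+ 4 * (N%:R * Num.sqrt N%:R) * (Num.sqrt B%:R)^-1.
    move=> BN; rewrite exchange_big /=.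
    apply: (@le_trans _ _ (\sum_(1 <= l < N.+1) 2 * T%:R * G B l)).
      by apply: ler_sum_nat => l lN; apply: inner.
    rewrite -mulr_sumr /G -mulr_sumr.
    apply: (@le_trans _ _ (2 * T%:R * (16 * T%:R ^+ 2 * (N%:R * Num.sqrt N%:R) *
       (Num.sqrt B%:R)^-1 * T%:R))); last first.
      by rewrite le_eqVlt; apply/orP; left; apply/eqP; ring.
    rewrite ler_wpM2l ?mulr_ge0 // ler_wpM2l ?mulr_ge0 ?exprn_ge0 ?invr_ge0 ?sqrtr_ge0 //.
    exact: harmonic_leq_tau.
  have outer (e : bool) :
      \sum_(t | t != 0) \sum_(1 <= B < N.+1) \sum_(1 <= l < N.+1)
        \sum_(g <- divisors l) (rel e B l g t)%:R * G B l
      <= 64 * T%:R ^+ 4 * N%:R ^+ 2.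
    rewrite exchange_big /=.
    apply: (@le_trans _ _ (\sum_(1 <= B < N.+1)
      32 * T%:R ^+ 4 * (N%:R * Num.sqrt N%:R) * (Num.sqrt B%:R)^-1)).
      by apply: ler_sum_nat => B BN; apply: middle.
    rewrite -mulr_sumr; apply: (le_trans (ler_wpM2l _ (sum_inv_sqrt R N))).
      by rewrite !mulr_ge0 ?exprn_ge0 ?sqrtr_ge0.
    have sN : Num.sqrt N%:R * Num.sqrt N%:R = N%:R :> R by rewrite -expr2 sqr_sqrtr.
    rewrite le_eqVlt; apply/orP; left; apply/eqP.
    transitivity (64 * T%:R ^+ 4 * N%:R * (Num.sqrt N%:R * Num.sqrt N%:R) : R).
      by ring.
    by rewrite sN; ring.
  rewrite exchange_big /= big_cons big_seq1.
  apply: (le_trans (lerD (outer true) (outer false))).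
  by rewrite le_eqVlt; apply/orP; left; apply/eqP; ring.
have J0 : (ndiff U 0)%:R <= 2 * N%:R :> R.
  by rewrite ndiff0 -natrM ler_nat card_root_set.
have sumJ : \sum_(t | t != 0) (ndiff U t)%:R <= 4 * N%:R ^+ 2 :> R.
  apply: (@le_trans _ _ ((\sum_t ndiff U t)%N%:R)).
    rewrite natr_sum [leRHS](bigD1 0) //= lerDr //.
  rewrite sum_ndiff -natrX -natrM ler_nat.
  by rewrite (_ : 4 * N ^ 2 = (2 * N) ^ 2)%N ?leq_exp2r ?card_root_set // expnMn.
rewrite (bigD1 0) //=.
have part1 : (ndiff U 0)%:R ^+ 2 <= 4 * N%:R ^+ 2 :> R.
  have -> : 4 * N%:R ^+ 2 = (2 * N%:R) ^+ 2 :> R by ring.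
  by rewrite lerXn2r ?nnegrE ?mulr_ge0.
have part2 : \sum_(t | t != 0) (ndiff U t)%:R ^+ 2 <=
    10 * T%:R * (1 + S) * (4 * N%:R ^+ 2) + 128 * T%:R ^+ 4 * N%:R ^+ 2.
  apply: (le_trans (ler_sum _ main)); rewrite big_split /=; apply: lerD => //.
  by rewrite -mulr_sumr ler_wpM2l // !mulr_ge0 ?addr_ge0.
apply: (le_trans (lerD part1 part2)).
have T14 : 1 <= T%:R ^+ 4 :> R by rewrite exprn_ege1.
have T4 : T%:R <= T%:R ^+ 4 :> R by rewrite ler_eXnr.
have NS : 0 <= N%:R ^+ 2 * S by rewrite mulr_ge0 ?exprn_ge0.
have N2 : 0 <= N%:R ^+ 2 :> R by rewrite exprn_ge0.
move: (T%:R : R) (T%:R ^+ 4 : R) (N%:R ^+ 2 : R) T14 T4 NS N2 T1.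
move=> T' T4' N2 T14 T4 NS N20 T1'.
have i1 : N2 * (1 + S) * T' <= N2 * (1 + S) * T4'.
  by rewrite ler_wpM2l // mulr_ge0 ?addr_ge0.
have i2 : N2 <= N2 * (1 + S) * T4'.
  by rewrite -mulrA ler_peMr // mulr_ege1 // lerDl.
have i3 : N2 * T4' <= N2 * (1 + S) * T4'.
  by rewrite ler_wpM2r ?(le_trans ler01 T14) // ler_peMr // lerDl.
nra.
Qed.

(* Imported late: classical_sets shadows the set comprehensions of finset. *)
From mathcomp Require Import all_classical all_reals all_analysis.
From mathcomp Require Import complex.
Import numFieldNormedType.Exports.

Local Open Scope complex_scope.

(** * Bilinear forms *)

Lemma cmod_normE (R : realType) (z : R[i]) : (cmod z)%:C = `|z|.
Proof. by rewrite /cmod normc_def. Qed.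

Lemma cmod_ge0 (R : realType) (z : R[i]) : 0 <= cmod z.
Proof. by rewrite -ler0c cmod_normE. Qed.

Lemma cmodM (R : realType) (x y : R[i]) : cmod (x * y) = cmod x * cmod y.
Proof. by apply: complexI; rewrite rmorphM !cmod_normE normrM. Qed.

Lemma cmod0 (R : realType) : cmod (0 : R[i]) = 0.
Proof. by apply: complexI; rewrite cmod_normE normr0. Qed.

Lemma cmod_real (R : realType) (x : R) : 0 <= x -> cmod x%:C = x.
Proof. by move=> x0; apply: complexI; rewrite cmod_normE ger0_norm ?ler0c. Qed.

Lemma cmod_conjc (R : realType) (z : R[i]) : cmod (conjc z) = cmod z.
Proof. by apply: complexI; rewrite !cmod_normE normcJ. Qed.

Lemma sqr_cmod (R : realType) (z : R[i]) : (cmod z ^+ 2)%:C = z * conjc z.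
Proof. by rewrite rmorphXn /= cmod_normE sqr_normc. Qed.

Lemma ler_cmod_sum (R : realType) (I : Type) (s : seq I) (P : pred I) (F : I -> R[i]) :
  cmod (\sum_(i <- s | P i) F i) <= \sum_(i <- s | P i) cmod (F i).
Proof.
rewrite -lecR cmod_normE rmorph_sum /=.
by apply: le_trans (ler_norm_sum _ _ _) _; apply: ler_sum => i _; rewrite cmod_normE.
Qed.

(** Lagrange's identity: the double sum of squared minors equals [2 (A B - C^2)]. *)
Lemma cauchy_schwarz (R : realDomainType) (I : finType) (P : pred I) (x y : I -> R) :
  (\sum_(i | P i) x i * y i) ^+ 2 <=
  (\sum_(i | P i) x i ^+ 2) * (\sum_(i | P i) y i ^+ 2).
Proof.
set A := \sum_(i | P i) x i ^+ 2; set B := \sum_(i | P i) y i ^+ 2.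
set C := \sum_(i | P i) x i * y i.
have : 0 <= \sum_(i | P i) \sum_(j | P j) (x i * y j - x j * y i) ^+ 2.
  by do 2![apply: sumr_ge0 => ? _]; apply: sqr_ge0.
have -> : \sum_(i | P i) \sum_(j | P j) (x i * y j - x j * y i) ^+ 2 =
    A * B + A * B - (C ^+ 2 + C ^+ 2).
  have e1 : A * B = \sum_(i | P i) \sum_(j | P j) x i ^+ 2 * y j ^+ 2.
    by rewrite mulr_suml; apply: eq_bigr => i _; rewrite mulr_sumr.
  have e2 : A * B = \sum_(i | P i) \sum_(j | P j) x j ^+ 2 * y i ^+ 2.
    by rewrite e1 exchange_big.
  have e3 : C ^+ 2 = \sum_(i | P i) \sum_(j | P j) x i * y i * (x j * y j).
    by rewrite expr2 mulr_suml; apply: eq_bigr => i _; rewrite mulr_sumr.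
  rewrite [X in X + _ - _]e1 [X in _ + X - _]e2 e3 -!big_split /= -sumrB.
  apply: eq_bigr => i _; rewrite -!big_split /= -sumrB.
  by apply: eq_bigr => j _; ring.
lra.
Qed.

Lemma sqr_sum_leq (R : realDomainType) (I : finType) (A : {set I}) (x : I -> R) :
  (\sum_(i in A) x i) ^+ 2 <= #|A|%:R * \sum_(i in A) x i ^+ 2.
Proof.
have := cauchy_schwarz (mem A) (fun=> 1) x.
by rewrite (eq_bigr x) => [|i _]; rewrite ?mul1r // expr1n sumr_const.
Qed.

(** The last clause makes the character nontrivial, as orthogonality requires. *)
Definition additive_character (R : realType) (F : finFieldType) (psi : F -> R[i]) :=
  [/\ {morph psi : x y / x + y >-> x * y}, forall x, cmod (psi x) = 1
    & exists x, psi x != 1].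

Lemma character0 (R : realType) (F : finFieldType) (psi : F -> R[i]) :
  additive_character psi -> psi 0 = 1.
Proof.
move=> psiP; have [psiD psi1 _] := psiP.
have p0 : psi 0 != 0.
  by apply/eqP => e; have := psi1 0; rewrite e cmod0 => /eqP; rewrite eq_sym oner_eq0.
by apply: (mulfI p0); rewrite -psiD addr0 mulr1.
Qed.

Lemma characterN (R : realType) (F : finFieldType) (psi : F -> R[i]) x :
  additive_character psi -> psi (- x) = conjc (psi x).
Proof.
move=> psiP; have [psiD psi1 _] := psiP.
have px : psi x * conjc (psi x) = 1 by rewrite -sqr_cmod psi1 expr1n.
have p0 : psi x != 0.
  by apply: contra_eq_neq px => ->; rewrite mul0r eq_sym oner_eq0.
by apply: (mulfI p0); rewrite -psiD subrr (character0 psiP) px.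
Qed.

Lemma sum_character (R : realType) (F : finFieldType) (psi : F -> R[i]) y :
  additive_character psi -> \sum_x psi (x * y) = (#|F| * (y == 0))%:R.
Proof.
move=> psiP; have [psiD psi1 [c c1]] := psiP.
have [->|y0] := eqVneq y 0.
  under eq_bigr do rewrite mulr0 (character0 psiP).
  by rewrite sumr_const cardT muln1 -cardE.
rewrite muln0; set S := \sum_x _; apply/eqP.
have e : psi c * S = S.
  rewrite /S mulr_sumr [RHS](reindex_inj (addrI (c / y))) /=.
  by apply: eq_bigr => x _; rewrite -psiD mulrDl divfK.
have : (psi c - 1) * S = 0 by rewrite mulrBl e mul1r subrr.
by move/eqP; rewrite mulf_eq0 subr_eq0 (negPf c1).
Qed.

Lemma parseval (R : realType) (F : finFieldType) (psi : F -> R[i])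
    (f : F -> R[i]) : additive_character psi ->
  \sum_t cmod (\sum_s f s * psi (t * s)) ^+ 2 = #|F|%:R * \sum_s cmod (f s) ^+ 2.
Proof.
move=> psiP; apply: complexI; rewrite rmorphM rmorph_nat !rmorph_sum /=.
have e t : (cmod (\sum_s f s * psi (t * s)) ^+ 2)%:C =
    \sum_s \sum_s' f s * psi (t * s) * conjc (f s' * psi (t * s')).
  rewrite sqr_cmod rmorph_sum /= mulr_suml.
  by apply: eq_bigr => s _; rewrite mulr_sumr.
under eq_bigr do rewrite e.
rewrite exchange_big /= mulr_sumr; apply: eq_bigr => s _.
rewrite exchange_big /= (bigD1 s) //= [X in _ + X]big1 => [|s' s's].
  rewrite addr0.
  transitivity (\sum_(t : F) f s * conjc (f s)); last first.
    by rewrite sumr_const cardT -cardE sqr_cmod mulr_natl.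
  apply: eq_bigr => t _; rewrite rmorphM mulrACA -(sqr_cmod (psi _)).
  by have [_ -> _] := psiP; rewrite expr1n mulr1.
transitivity (\sum_t f s * conjc (f s') * psi (t * (s - s'))).
  apply: eq_bigr => t _; rewrite rmorphM mulrACA /= -(characterN _ psiP).
  by have [<- _ _] := psiP; rewrite -mulrBr.
rewrite -mulr_sumr (sum_character _ psiP) subr_eq0 eq_sym (negPf s's) muln0 mulr0 //.
Qed.

Lemma sum_pairs_ndiff (R : pzRingType) (V : finZmodType) (U : {set V}) (f : V -> R) :
  \sum_(u in U) \sum_(v in U) f (u - v) = \sum_t (ndiff U t)%:R * f t.
Proof.
rewrite pair_big_dep /= (partition_big (fun x => x.1 - x.2) predT) //=.
apply: eq_bigr => t _; rewrite /ndiff mulr_natl -sumr_const.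
apply: eq_big => [[u v]|[u v] /andP[_ /eqP <-] //].
by rewrite !inE.
Qed.

(* Two applications of Cauchy's inequality reduce the sum to the moment
   [\sum_t ndiff V t * `|\sum_(u in U) psi (t u)| ^ 2], and the fourth moment of
   the inner sum is [#|F|] times the additive energy of [U]. *)
Lemma bilinear_large_sieve (R : realType) (F : finFieldType) (psi : F -> R[i])
    (U V : {set F}) (a b : F -> R[i]) :
  additive_character psi ->
  (forall u, u \in U -> cmod (a u) <= 1) -> (forall v, v \in V -> cmod (b v) <= 1) ->
  cmod (\sum_(u in U) \sum_(v in V) a u * b v * psi (u * v)) ^+ 8 <=
  #|F|%:R * #|U|%:R ^+ 4 * #|V|%:R ^+ 4 *
  (\sum_t (ndiff U t)%:R ^+ 2) * (\sum_t (ndiff V t)%:R ^+ 2).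
Proof.
move=> psiP a1 b1; set S := \sum_(u in U) _.
have [psiD psi1 _] := psiP.
pose g u := \sum_(v in V) b v * psi (u * v).
pose fU t := \sum_(u in U) psi (u * t).
pose Y := \sum_(v in V) \sum_(v' in V) cmod (fU (v - v')).
pose Z := \sum_t (ndiff V t)%:R * cmod (fU t) ^+ 2.
have Y0 : 0 <= Y by do 2![apply: sumr_ge0 => ? _]; apply: cmod_ge0.
have Z0 : 0 <= Z by apply: sumr_ge0 => ? _; rewrite mulr_ge0 // exprn_ge0 ?cmod_ge0.
have S1 : cmod S <= \sum_(u in U) cmod (g u).
  apply: (le_trans (ler_cmod_sum _ _ _)); apply: ler_sum => u uU.
  under eq_bigr do rewrite -mulrA.
  by rewrite -mulr_sumr cmodM ler_piMl ?cmod_ge0 // a1.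
have gY : \sum_(u in U) cmod (g u) ^+ 2 <= Y.
  have -> : \sum_(u in U) cmod (g u) ^+ 2 =
      cmod (\sum_(v in V) \sum_(v' in V) b v * conjc (b v') * fU (v - v')).
    (* A nonnegative real is its own modulus, so the identity can be checked in [R[i]]. *)
    rewrite -[LHS]cmod_real; last by apply: sumr_ge0 => ? _; rewrite exprn_ge0 ?cmod_ge0.
    congr cmod; rewrite rmorph_sum /=.
    under [RHS]eq_bigr => v _.
      under eq_bigr do rewrite mulr_sumr.
      rewrite exchange_big /=; over.
    rewrite [RHS]exchange_big /=; apply: eq_bigr => u _.
    rewrite sqr_cmod /g rmorph_sum /= mulr_suml; apply: eq_bigr => v _.
    rewrite mulr_sumr; apply: eq_bigr => v' _.
    by rewrite mulrBr psiD (characterN _ psiP) rmorphM /= mulrACA.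
  apply: (le_trans (ler_cmod_sum _ _ _)); apply: ler_sum => v vV.
  apply: (le_trans (ler_cmod_sum _ _ _)); apply: ler_sum => v' v'V.
  rewrite 2!cmodM cmod_conjc ler_piMl ?cmod_ge0 //.
  by rewrite mulr_ile1 ?cmod_ge0 ?b1.
have S2 : cmod S ^+ 2 <= #|U|%:R * Y.
  apply: (@le_trans _ _ ((\sum_(u in U) cmod (g u)) ^+ 2)).
    by rewrite lerXn2r ?nnegrE ?cmod_ge0 ?sumr_ge0 // => ? _; apply: cmod_ge0.
  by apply: (le_trans (sqr_sum_leq _ _)); rewrite ler_wpM2l.
have Y2 : Y ^+ 2 <= #|V|%:R ^+ 2 * Z.
  apply: (le_trans (sqr_sum_leq _ _)); rewrite expr2 -mulrA ler_wpM2l //.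
  apply: (@le_trans _ _ (\sum_(v in V) #|V|%:R * \sum_(v' in V) cmod (fU (v - v')) ^+ 2)).
    by apply: ler_sum => v _; apply: sqr_sum_leq.
  by rewrite -mulr_sumr (sum_pairs_ndiff V (fun t => cmod (fU t) ^+ 2)).
have Z2 : Z ^+ 2 <= (\sum_t (ndiff V t)%:R ^+ 2) * (#|F|%:R * \sum_t (ndiff U t)%:R ^+ 2).
  apply: (le_trans (cauchy_schwarz _ _ _)); rewrite ler_wpM2l //.
    by apply: sumr_ge0 => ? _; rewrite exprn_ge0.
  (* The function [|fU|^2] is the Fourier transform of [ndiff U], which lets Parseval produce the
     energy of [U]. *)
  have e t : cmod (fU t) ^+ 2 = cmod (\sum_s (ndiff U s)%:R * psi (t * s)).
    have <- : (cmod (fU t) ^+ 2)%:C = \sum_s (ndiff U s)%:R * psi (t * s).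
      rewrite -(sum_pairs_ndiff U (fun s => psi (t * s))) sqr_cmod /fU.
      rewrite rmorph_sum mulr_suml.
      apply: eq_bigr => u _; rewrite mulr_sumr; apply: eq_bigr => v _.
      by rewrite mulrBr psiD (characterN _ psiP) !(mulrC t).
    by rewrite cmod_real // exprn_ge0 ?cmod_ge0.
  under eq_bigr do rewrite e.
  rewrite (parseval _ psiP) ler_wpM2l //; apply: ler_sum => s _.
  by rewrite -(rmorph_nat (real_complex R)) cmod_real.
have -> : cmod S ^+ 8 = ((cmod S ^+ 2) ^+ 2) ^+ 2 by rewrite -!exprM.
have S4 : (cmod S ^+ 2) ^+ 2 <= (#|U|%:R * Y) ^+ 2.
  by rewrite lerXn2r ?nnegrE ?exprn_ge0 ?mulr_ge0 ?cmod_ge0.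
have {}S4 : (cmod S ^+ 2) ^+ 2 <= #|U|%:R ^+ 2 * (#|V|%:R ^+ 2 * Z).
  by apply: (le_trans S4); rewrite exprMn ler_wpM2l ?exprn_ge0.
apply: (@le_trans _ _ ((#|U|%:R ^+ 2 * (#|V|%:R ^+ 2 * Z)) ^+ 2)).
  by rewrite lerXn2r ?nnegrE ?exprn_ge0 ?mulr_ge0 ?cmod_ge0 ?exprn_ge0.
rewrite !exprMn; apply: (le_trans (ler_wpM2l _ (ler_wpM2l _ Z2))); rewrite ?exprn_ge0 //.
by rewrite le_eqVlt; apply/orP; left; apply/eqP; ring.
Qed.

(** * Reduction to bilinear forms *)

Lemma add_charD (R : realType) (q : nat) (y z : int) :
  add_char R q (y + z) = add_char R q y * add_char R q z.
Proof.
rewrite /add_char intrD mulrDr mulrDl cosD sinD.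
by congr (_ +i* _); rewrite addrC; congr (_ + _); rewrite mulrC.
Qed.

Lemma add_char0 (R : realType) (q : nat) : add_char R q 0 = 1.
Proof. by rewrite /add_char mulr0 mul0r cos0 sin0. Qed.

Lemma add_char_period (R : realType) (q : nat) (z : int) : (0 < q)%N ->
  add_char R q (q%:Z * z) = 1.
Proof.
move=> q0.
have nat_case (n : nat) : add_char R q (q%:Z * n%:Z) = 1.
  rewrite /add_char.
  have -> : 2 * pi * (q%:Z * n%:Z)%:~R / q%:R = 0 + (pi *+ 2) *+ n :> R.
    rewrite intrM -!pmulrn -[in RHS]mulr_natr -[pi *+ 2]mulr_natr.
    by field; rewrite pnatr_eq0 -lt0n.
  by rewrite (periodicn (@cosD2pi R)) (periodicn (@sinD2pi R)) cos0 sin0.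
have [z0|z0] := leP 0 z; first by rewrite -(gez0_abs z0).
have := add_charD R q (q%:Z * z) (q%:Z * `|z|%N).
by rewrite nat_case mulr1 -mulrDr ltz0_abs // subrr mulr0 add_char0.
Qed.

Lemma eq_add_char (R : realType) (q : nat) (y z : int) : prime q ->
  y%:~R = z%:~R :> 'F_q -> add_char R q y = add_char R q z.
Proof.
move=> pq yz; have : (q%:Z %| y - z)%Z by rewrite -intr_Fp_eq0 // intrB yz subrr.
move=> /dvdzP[k kE]; rewrite -(subrK z y) kE add_charD mulrC.
by rewrite (mulrC k) add_char_period ?prime_gt0 ?mulr1.
Qed.

Lemma cmod_add_char (R : realType) (q : nat) (z : int) : cmod (add_char R q z) = 1.
Proof. by rewrite /cmod normc_def /= cos2Dsin2 sqrtr1. Qed.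

(** With [t = pi / q], the value 1 would force [cos (2 t) = 1], hence [sin t = 0], although
    [0 < t < pi]. *)
Lemma add_char1_neq1 (R : realType) (q : nat) : (1 < q)%N -> add_char R q 1 != 1.
Proof.
move=> q1; have q0 : 0 < q%:R :> R by rewrite ltr0n ltnW.
apply/eqP => -[]; set t : R := pi / q%:R.
have -> : 2 * pi * 1%:~R / q%:R = t *+ 2 :> R by rewrite mulr1 -[RHS]mulr_natl mulrA.
rewrite cos_mulr2n => c1 _.
have : 0 < sin t.
  apply: sin_gt0_pi; rewrite divr_gt0 ?pi_gt0 //= ltr_pdivrMr //.
  by rewrite ltr_pMr ?pi_gt0 // ltr1n.
have := cos2Dsin2 t; nra.
Qed.

Lemma add_char_additive (R : realType) (q : nat) (h : int) : prime q ->
  ~~ (q%:Z %| h)%Z ->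
  additive_character (fun x : 'F_q => add_char R q (h * (nat_of_ord x)%:Z)).
Proof.
move=> pq qh.
have valE (x : 'F_q) : (nat_of_ord x)%:Z%:~R = x :> 'F_q by rewrite -pmulrn natr_Zp.
(* At the inverse of [h] the character takes the value [add_char R q 1], which is not 1. *)
split=> [x y|x|]; last 1 [exists (h%:~R)^-1].
- by rewrite -add_charD -mulrDr; apply: eq_add_char; rewrite // !(intrM, intrD) !valE.
- exact: cmod_add_char.
have -> : add_char R q (h * (nat_of_ord (h%:~R : 'F_q)^-1)%:Z) = add_char R q 1.
  by apply: eq_add_char => //; rewrite intrM valE mulfV // intr_Fp_eq0.
by rewrite add_char1_neq1 ?prime_gt1.
Qed.

(* For each nonzero [u], the substitution [x = u v] identifies the solutions of
   [x ^ 2 = k n] with those of [v ^ 2 = n / c], where [c = u ^ 2 / k]. *)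
Lemma sum_sqr_factor (F : finFieldType) (S : comPzRingType) (f : F -> S) (k n : F) :
  k != 0 -> 
  \sum_(c | c != 0) \sum_u \sum_v
    (u ^+ 2 == c * k)%:R * (v ^+ 2 == c^-1 * n)%:R * f (u * v) =
  #|F|.-1%:R * \sum_(x | x ^+ 2 == k * n) f x.
Proof.
move=> k0; rewrite exchange_big /=.
transitivity (\sum_(u : F | u != 0) \sum_(x | x ^+ 2 == k * n) f x); last first.
  by rewrite sumr_const -(cardC1 (0 : F)) mulr_natl; congr (_ *+ _); apply: eq_card.
rewrite (bigD1 0) //= big1 ?add0r => [|c c0]; last first.
  rewrite big1 // => v _.
  by rewrite expr0n /= eq_sym mulf_eq0 (negPf c0) (negPf k0) !mul0r.
apply: eq_bigr => u u0.
have c0 : u ^+ 2 / k != 0 by rewrite mulf_neq0 ?invr_neq0 ?expf_neq0.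
rewrite (bigD1 (u ^+ 2 / k)) //= [X in _ + X]big1 ?addr0; last first.
  move=> c /andP[_ cu]; rewrite big1 // => v _.
  have /negPf -> : u ^+ 2 != c * k; last by rewrite !mul0r.
  by apply: contraNneq cu => ->; rewrite mulfK.
rewrite [RHS]big_mkcond [RHS](reindex_inj (mulfI u0)) /=.
apply: eq_bigr => v _; rewrite divfK // eqxx mul1r.
have -> : (v ^+ 2 == (u ^+ 2 / k)^-1 * n) = ((u * v) ^+ 2 == k * n).
  rewrite -(inj_eq (mulfI c0)) mulVKf // -(inj_eq (mulfI k0)) exprMn.
  by congr (_ == _); field.
by case: ifP => _; rewrite ?mul1r ?mul0r.
Qed.

Lemma exchange_bilinear (S : comPzRingType) (F : finType) (I J : Type) (s : seq I)
    (t : seq J) (P : pred I) (Q : pred J) (f : I -> F -> S) (g : J -> F -> S)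
    (h : F -> F -> S) :
  \sum_u \sum_v (\sum_(i <- s | P i) f i u) * (\sum_(j <- t | Q j) g j v) * h u v =
  \sum_(i <- s | P i) \sum_(j <- t | Q j) \sum_u \sum_v f i u * g j v * h u v.
Proof.
have e u v : (\sum_(i <- s | P i) f i u) * (\sum_(j <- t | Q j) g j v) * h u v =
    \sum_(i <- s | P i) \sum_(j <- t | Q j) f i u * g j v * h u v.
  rewrite !mulr_suml; apply: eq_bigr => i _.
  by rewrite mulr_sumr mulr_suml.
transitivity (\sum_u \sum_(i <- s | P i) \sum_(j <- t | Q j) \sum_v
  f i u * g j v * h u v).
  apply: eq_bigr => u _; under eq_bigr do rewrite e.
  by rewrite exchange_big; apply: eq_bigr => i _; rewrite exchange_big.
by rewrite exchange_big; apply: eq_bigr => i _; rewrite exchange_big.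
Qed.

(** The weights carried over to the square roots. For [b != 0] and [2 N <= q] at most one [n]
    contributes, so the value is a single [alpha n] or 0. *)
Definition sqr_coef (R : realType) (q : nat) (b : 'F_q) (N : nat)
    (alpha : nat -> R[i]) (u : 'F_q) : R[i] :=
  \sum_(0 <= n < N | (N <= 2 * n)%N) alpha n * (u ^+ 2 == b * n%:R)%:R.

Lemma sqr_coef_supp (R : realType) (q : nat) (b : 'F_q) (N : nat)
    (alpha : nat -> R[i]) (u : 'F_q) :
  prime q -> (2 * N <= q)%N -> b != 0 -> u \notin root_set b N ->
  sqr_coef b N alpha u = 0.
Proof.
move=> pq Nq b0 uU; rewrite /sqr_coef big_nat_cond big1 // => n /andP[/andP[_ nN] Nn].
have n0 : n%:R != 0 :> 'F_q.
  apply: natr_Fp_neq0 => //; move: nN Nn Nq; clear; lia.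
have [e|] := eqVneq (u ^+ 2) (b * n%:R); last by rewrite mulr0.
case/negP: uU; rewrite inE; apply/andP; split.
  by rewrite -sqrf_eq0 e mulf_neq0.
by apply/existsP; exists (Ordinal nN); rewrite /= Nn e eqxx.
Qed.

Lemma weight_norm_leq (R : realType) (N : nat) (alpha : nat -> R[i]) (n : nat) :
  (n < N)%N -> (N <= 2 * n)%N -> cmod (alpha n) <= weight_norm N alpha.
Proof.
move=> nN Nn; rewrite /weight_norm.
by apply: (le_bigmax_seq 0 n (fun n => (N <= 2 * n)%N) (fun n => cmod (alpha n)));
  rewrite ?mem_index_iota.
Qed.

Lemma cmod_sqr_coef (R : realType) (q : nat) (b : 'F_q) (N : nat)
    (alpha : nat -> R[i]) (u : 'F_q) :
  prime q -> (2 * N <= q)%N -> b != 0 -> weight_norm N alpha <= 1 ->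
  cmod (sqr_coef b N alpha u) <= 1.
Proof.
move=> pq Nq b0 a1; apply: (le_trans (ler_cmod_sum _ _ _)).
pose P n := (u ^+ 2 == b * n%:R).
apply: (@le_trans _ _ (\sum_(0 <= n < N) (P n)%:R)).
  rewrite big_mkcond /=; apply: ler_sum_nat => n /andP[_ nN].
  case: ifP => [Nn|_]; last by rewrite ler0n.
  rewrite cmodM -(rmorph_nat (real_complex R)) cmod_real ?ler0n //.
  apply: ler_piMl; first by rewrite ler0n.
  exact: le_trans (weight_norm_leq _ nN Nn) a1.
rewrite -natr_sum -[1]/(1%:R) ler_nat.
have -> : (\sum_(0 <= n < N) P n = size [seq n <- index_iota 0 N | P n])%N.
  by rewrite size_filter -sum1_count [RHS]big_mkcond.
case E : [seq n <- _ | _] => [//|m s].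
have: m \in [seq n <- index_iota 0 N | P n] by rewrite E mem_head.
rewrite mem_filter mem_index_iota => /andP[/eqP mP mN].
rewrite -E -[X in (_ <= X)%N]/(size [:: m]); apply: uniq_leq_size.
  by rewrite filter_uniq ?iota_uniq.
move=> n; rewrite mem_filter mem_index_iota mem_seq1 => /andP[/eqP nP nN].
have /(mulfI b0) e : b * n%:R = b * m%:R by rewrite -nP -mP.
have : (n%:Z - m%:Z)%:~R = 0 :> 'F_q by rewrite intrB -!pmulrn e subrr.
move=> nm; rewrite -eqz_nat -subr_eq0; apply/eqP; apply: small_intr_Fp_eq0 pq _ nm.
by move: mN nN Nq; clear; lia.
Qed.

(** [sum_sqr_factor] is applied to each pair [m, n] with [k = a m], nonzero modulo [q]. Each nonzero
    [c] gives one bilinear form, over [u^2 = c a m] and [v^2 = n / c]. *)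
Lemma W_average (R : realType) (q : nat) (a h : int) (M N : nat)
    (alpha beta : nat -> R[i]) :
  prime q -> ~~ (q%:Z %| a)%Z -> (2 * M <= q)%N ->
  q.-1%:R * W q a alpha beta h M N =
  \sum_(c : 'F_q | c != 0) \sum_u \sum_v
    sqr_coef (c * a%:~R) M alpha u * sqr_coef c^-1 N beta v *
    add_char R q (h * (nat_of_ord (u * v))%:Z).
Proof.
move=> pq qa Mq; pose psi (x : 'F_q) := add_char R q (h * (nat_of_ord x)%:Z).
under eq_bigr do rewrite /sqr_coef exchange_bilinear.
rewrite exchange_big /= mulr_sumr [LHS]big_nat_cond [RHS]big_nat_cond.
apply: eq_bigr => m /andP[/andP[_ mM] Mm].
rewrite exchange_big /= mulr_sumr; apply: eq_bigr => n _.
have k0 : a%:~R * m%:R != 0 :> 'F_q.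
  rewrite mulf_neq0 // ?intr_Fp_eq0 //; apply: natr_Fp_neq0 => //.
  by move: mM Mm Mq; clear; lia.
have := sum_sqr_factor psi n%:R k0.
rewrite card_Fp // mulrCA => <-.
rewrite mulr_sumr; apply: eq_bigr => c _.
rewrite mulr_sumr; apply: eq_bigr => u _.
rewrite mulr_sumr; apply: eq_bigr => v _.
by rewrite -!mulrA; congr (_ * _); rewrite mulrCA !mulrA.
Qed.

Lemma max_tau_gt0 q : (0 < q)%N -> (0 < max_tau q)%N.
Proof.
by move=> q0; apply: leq_trans (leq_max_tau (n := 1) _); rewrite ?tau_gt0 ?expn_gt0 ?q0.
Qed.

Lemma cmod_sqr_sum_leq (R : realType) (q : nat) (h : int) (b b' : 'F_q) (M N : nat)
    (alpha beta : nat -> R[i]) :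
  prime q -> (2 < q)%N -> ~~ (q%:Z %| h)%Z -> (2 * M <= q)%N -> (2 * N <= q)%N ->
  b != 0 -> b' != 0 -> weight_norm M alpha <= 1 -> weight_norm N beta <= 1 ->
  cmod (\sum_u \sum_v sqr_coef b M alpha u * sqr_coef b' N beta v *
    add_char R q (h * (nat_of_ord (u * v))%:Z)) ^+ 8 <=
  q%:R * (8 * (max_tau q)%:R) ^+ 8 * (N%:R * M%:R) ^+ 6 *
  (1 + Num.sqrt (N%:R ^+ 3 / q%:R)) * (1 + Num.sqrt (M%:R ^+ 3 / q%:R)).
Proof.
move=> pq q2 qh Mq Nq b0 b'0 a1 b1.
set U := root_set b M; set V := root_set b' N; set T := max_tau q.
have T0 : (0 < T)%N by apply: max_tau_gt0; apply: prime_gt0.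
(* Both [M] and [N] are at most [q], so one value [T] serves both energies. *)
have tauT K : (2 * K <= q)%N -> forall n, (0 < n <= K ^ 2)%N -> (tau n <= T)%N.
  move=> Kq n /andP[n0 nK]; apply: leq_max_tau; rewrite n0 (leq_trans nK) //.
  by rewrite leq_exp2r //; move: Kq; clear; lia.
have -> : \sum_u \sum_v sqr_coef b M alpha u * sqr_coef b' N beta v *
    add_char R q (h * (nat_of_ord (u * v))%:Z) =
  \sum_(u in U) \sum_(v in V) sqr_coef b M alpha u * sqr_coef b' N beta v *
    add_char R q (h * (nat_of_ord (u * v))%:Z).
  rewrite [RHS]big_mkcond; apply: eq_bigr => u _; case: ifPn => uU.
    rewrite [RHS]big_mkcond; apply: eq_bigr => v _; case: ifPn => // vV.
    by rewrite (sqr_coef_supp _ pq Nq b'0 vV) mulr0 mul0r.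
  by rewrite big1 // => v _; rewrite (sqr_coef_supp _ pq Mq b0 uU) !mul0r.
have psiP := add_char_additive R pq qh.
apply: (le_trans (@bilinear_large_sieve _ _ _ U V _ _ psiP _ _)).
- by move=> u _; apply: cmod_sqr_coef.
- by move=> v _; apply: cmod_sqr_coef.
rewrite card_Fp //.
have EU := energy_root_set R pq q2 Mq T0 (tauT _ Mq) b0.
have EV := energy_root_set R pq q2 Nq T0 (tauT _ Nq) b'0.
have cU : #|U|%:R <= 2 * M%:R :> R by rewrite -natrM ler_nat card_root_set.
have cV : #|V|%:R <= 2 * N%:R :> R by rewrite -natrM ler_nat card_root_set.
have cU4 : #|U|%:R ^+ 4 <= (2 * M%:R) ^+ 4 :> R by rewrite lerXn2r ?nnegrE ?mulr_ge0.
have cV4 : #|V|%:R ^+ 4 <= (2 * N%:R) ^+ 4 :> R by rewrite lerXn2r ?nnegrE ?mulr_ge0.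
have E0 (W : {set 'F_q}) : 0 <= \sum_t (ndiff W t)%:R ^+ 2 :> R.
  by apply: sumr_ge0 => ? _; rewrite exprn_ge0.
set sM := Num.sqrt (M%:R ^+ 3 / q%:R) in EU *.
set sN := Num.sqrt (N%:R ^+ 3 / q%:R) in EV *.
have sM0 : 0 <= sM by apply: sqrtr_ge0.
have sN0 : 0 <= sN by apply: sqrtr_ge0.
(* [2 ^ 4 * 2 ^ 4 * 172 ^ 2 <= 8 ^ 8]; the power of two is kept symbolic. *)
set d : R := 2 in cU4 cV4.
have d0 : 0 <= d by rewrite /d.
have -> : 8 = d ^+ 3 :> R by rewrite /d; ring.
have d172 : 172 <= d ^+ 8 :> R by rewrite /d -natrX ler_nat.
have {}EU : \sum_t (ndiff U t)%:R ^+ 2 <= d ^+ 8 * T%:R ^+ 4 * M%:R ^+ 2 * (1 + sM) :> R.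
  by apply: le_trans EU _; do 3![apply: ler_wpM2r; rewrite ?exprn_ge0 ?addr_ge0 //].
have {}EV : \sum_t (ndiff V t)%:R ^+ 2 <= d ^+ 8 * T%:R ^+ 4 * N%:R ^+ 2 * (1 + sN) :> R.
  by apply: le_trans EV _; do 3![apply: ler_wpM2r; rewrite ?exprn_ge0 ?addr_ge0 //].
apply: (@le_trans _ _ (q%:R * (d * M%:R) ^+ 4 * (d * N%:R) ^+ 4 *
  (d ^+ 8 * T%:R ^+ 4 * M%:R ^+ 2 * (1 + sM)) *
  (d ^+ 8 * T%:R ^+ 4 * N%:R ^+ 2 * (1 + sN)))).
  apply: (ler_pM _ _ _ EV) => //; first by rewrite !mulr_ge0 ?exprn_ge0.
  apply: (ler_pM _ _ _ EU) => //.
  apply: (ler_pM _ _ _ cV4) => //; rewrite ?mulr_ge0 ?exprn_ge0 //.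
  by rewrite ler_wpM2l.
rewrite le_eqVlt; apply/orP; left; apply/eqP.
clear d0 d172 cU4 cV4 EU EV cU cV sM0 sN0; move: d sM sN.
move: (q%:R : R) (M%:R : R) (N%:R : R) (T%:R : R).
by clear; move=> *; ring.
Qed.

(** * The [o(1)] factor and the final exponents *)

Lemma powR_exprn (R : realType) (a t : R) (n : nat) : (a `^ t) ^+ n = a `^ (t * n%:R).
Proof. by rewrite -powR_mulrn ?powR_ge0 // -powRrM. Qed.

(** For [k >= 3 / eps], the divisor bound gives [U(V)^k <= C V^2 <= V^3 <= V^(eps k)] as soon as
    [V >= C] and [V >= 1]. *)
Lemma max_tau_Vo1 (R : realType) :
  is_Vo1 (fun V : R => 8 * (max_tau (Num.truncn V))%:R).
Proof.
move=> eps eps0; set k := (Num.truncn (3 / eps)).+1.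
have k0 : (0 < k)%N by [].
have epsk : 3 <= eps * k%:R.
  by rewrite mulrC -ler_pdivrMr // ltW // truncnS_gt.
set C : R := 8 ^+ k * ((k ^ k) ^ (2 ^ k))%N%:R.
near=> V.
have V1 : 1 <= V by near: V; apply: nbhs_pinfty_ge; rewrite num_real.
have VC : C <= V by near: V; apply: nbhs_pinfty_ge; rewrite num_real.
have V0 : 0 <= V by apply: le_trans V1.
rewrite ger0_norm ?mulr_ge0 // -(@ler_pXn2r _ k) ?nnegrE ?mulr_ge0 ?powR_ge0 //.
rewrite [leRHS]powR_exprn.
apply: (@le_trans _ _ (V `^ 3)); last exact: ler_powR.
rewrite -[3]/(3%:R) powR_mulrn // exprMn.
apply: (@le_trans _ _ (C * V ^+ 2)); last first.
  by rewrite [V ^+ 3]exprS ler_wpM2r // exprn_ge0.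
rewrite /C -mulrA ler_wpM2l ?exprn_ge0 //.
apply: (@le_trans _ _ (((k ^ k) ^ (2 ^ k))%N%:R * (Num.truncn V)%:R ^+ 2)).
  by rewrite -!natrX -natrM ler_nat max_tau_exp_leq.
rewrite ler_wpM2l // lerXn2r ?nnegrE // truncn_le //.
Unshelve. all: by end_near.
Qed.

(** With [x = N^(3/16) / q^(1/16)] the square root is [x^8], and [1 + x^8 <= (1 + x)^8]. *)
Lemma one_plus_sqrt_leq (R : realType) (N q : nat) : (0 < q)%N ->
  1 + Num.sqrt (N%:R ^+ 3 / q%:R) <=
  (N%:R `^ (3 / 16) / q%:R `^ (1 / 16) + 1) ^+ 8 :> R.
Proof.
move=> q0; set x : R := _ `^ _ / _.
have x0 : 0 <= x by rewrite divr_ge0 ?powR_ge0.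
have qq : 0 < q%:R :> R by rewrite ltr0n.
have -> : Num.sqrt (N%:R ^+ 3 / q%:R) = x ^+ 8.
  rewrite /x expr_div_n !powR_exprn -powR12_sqrt ?divr_ge0 ?exprn_ge0 //.
  rewrite powRM ?exprn_ge0 ?invr_ge0 //.
  congr (_ * _); first by rewrite -powR_mulrn // -powRrM; congr (_ `^ _); field.
  by rewrite -[q%:R^-1]powR_inv1 // -powRrM -powRN; congr (_ `^ _); field.
have y0 : 0 <= 1 + x by rewrite addr_ge0.
have -> : (x + 1) ^+ 8 = (1 + x) ^+ 7 + (1 + x) ^+ 7 * x by ring.
apply: lerD; first by rewrite exprn_ege1 // lerDl.
by rewrite exprSr ler_wpM2r // lerXn2r ?nnegrE // lerDr.
Qed.

Theorem corollary2p1 (R : realType) :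
  exists U : R -> R, is_Vo1 U /\
    forall (q : nat) (a h : int) (M N : nat) (alpha beta : nat -> R[i]),
      prime q ->
      ~~ (q%:Z %| a)%Z -> ~~ (q%:Z %| h)%Z ->
      (0 < M)%N -> (0 < N)%N ->
      M%:R <= q%:R / 2 :> R -> N%:R <= q%:R / 2 :> R ->
      weight_norm M alpha <= 1 -> weight_norm N beta <= 1 ->
      cmod (W q a alpha beta h M N) <=
        q%:R `^ (1 / 8) * U q%:R * (N%:R * M%:R) `^ (3 / 4) *
        (N%:R `^ (3 / 16) / q%:R `^ (1 / 16) + 1) *
        (M%:R `^ (3 / 16) / q%:R `^ (1 / 16) + 1).
Proof.
exists (fun V => 8 * (max_tau (Num.truncn V))%:R); split; first exact: max_tau_Vo1.
move=> q a h M N alpha beta pq qa qh M0 N0 Mq Nq a1 b1.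
rewrite natrK.
have half K : K%:R <= q%:R / 2 :> R -> (2 * K <= q)%N.
  by rewrite ler_pdivlMr // -natrM ler_nat mulnC.
move: Mq Nq => /half Mq /half Nq.
have q0 : (0 < q)%N by apply: prime_gt0.
have qR : 0 < q%:R :> R by rewrite ltr0n.
set X := (X in _ <= X).
have X0 : 0 <= X.
  by rewrite !mulr_ge0 ?powR_ge0 ?addr_ge0 ?divr_ge0 ?powR_ge0.
(* For [q = 2] only [M = 1] is possible, and no [m] satisfies [1/2 <= m < 1]. *)
have [q2|q2] := leqP q 2.
  suff -> : W q a alpha beta h M N = 0 by rewrite cmod0.
  have -> : M = 1%N by move: M0 Mq q2; clear; lia.
  by rewrite /W big_nat_cond big1 // => m; case: m.
have X8 (b b' : 'F_q) : b != 0 -> b' != 0 ->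
  cmod (\sum_u \sum_v sqr_coef b M alpha u * sqr_coef b' N beta v *
    add_char R q (h * (nat_of_ord (u * v))%:Z)) <= X.
  (* In eighth powers the exponents 1/8 and 3/4 become 1 and 6, matching [cmod_sqr_sum_leq]. *)
  move=> b0 b'0; rewrite -(@ler_pXn2r _ 8) ?nnegrE ?cmod_ge0 //.
  apply: (le_trans (cmod_sqr_sum_leq pq q2 qh Mq Nq b0 b'0 a1 b1)).
  rewrite /X !(exprMn 8).
  have -> : (q%:R `^ (1 / 8)) ^+ 8 = q%:R :> R.
    by rewrite powR_exprn mul1r mulVf ?pnatr_eq0 // powRr1 // ltW.
  have -> : ((N%:R * M%:R) `^ (3 / 4)) ^+ 8 = (N%:R * M%:R) ^+ 6 :> R.
    rewrite powR_exprn -[RHS]powR_mulrn ?mulr_ge0 //.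
    by congr (_ `^ _); field.
  have sq0 K : 0 <= 1 + Num.sqrt (K%:R ^+ 3 / q%:R) :> R by rewrite addr_ge0 ?sqrtr_ge0.
  apply: ler_pM => //; last exact: one_plus_sqrt_leq.
  by apply: ler_pM => //; exact: one_plus_sqrt_leq.
(* By [W_average], [(q - 1) W] is a sum of [q - 1] bilinear forms, each at most [X] in modulus. *)
have q1 : 0 < q.-1%:R :> R by rewrite ltr0n; move: q2; clear; lia.
rewrite -(ler_pM2l q1).
have <- : cmod (q.-1%:R * W q a alpha beta h M N) =
    q.-1%:R * cmod (W q a alpha beta h M N).
  by rewrite cmodM -(rmorph_nat (real_complex R)) cmod_real ?ltW.
rewrite (W_average _ _ _ _ pq qa Mq).
apply: (le_trans (ler_cmod_sum _ _ _)).
apply: (@le_trans _ _ (\sum_(c : 'F_q | c != 0) X)).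
  apply: ler_sum => c c0; apply: X8; last by rewrite invr_neq0.
  by rewrite mulf_neq0 // intr_Fp_eq0.
rewrite sumr_const -[X in X <= _]mulr_natl ler_wpM2r // ler_nat.
have <- : #|predC1 (0 : 'F_q)| = q.-1 by rewrite cardC1 card_Fp.
by apply: eq_leq; apply: eq_card.
Qed.
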